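(* Let $R$ be a $d$-dimensional Gorenstein quasi-fiber product ring with respect to the regular sequence $\underline x=x_1,\ldots,x_n$. Let $M$ and $N$ be nonzero finitely generated $R$-modules. If $N$ is Tor-rigid, and there is an integer $t>n$ such that $\operatorname{Ext}^i_R(M,N)=0$ whenever $t\le i\le t+n$, then $\operatorname{pd}_R M<\infty$ or $\operatorname{pd}_R N<\infty$.
   Context: All local rings are commutative and Noetherian, and all modules are finitely generated; $\operatorname{pd}$ denotes projective dimension. A local ring $(R,\mathfrak m,k)$ is a fiber product ring if $R\cong S\times_k T=\{(s,t)\in S\times T : \pi_S(s)=\pi_T(t)\}$, where $S,T$ are local rings with the same residue field $k$, neither of them equal to $k$, and $\pi_S,\pi_T$ are the reductions modulo the maximal ideals. Equivalently, $\mathfrak m=I\oplus J$ for nonzero ideals $I,J$ of $R$. A local ring $R$ is a quasi-fiber product ring with respect to $\underline x=x_1,\dots,x_n$ ($n\ge 0$) if $\underline x$ is an $R$-regular sequence such that $R/(\underline x)$ is a fiber product ring. An $R$-module $N$ is Tor-rigid if for every $R$-module $Z$ and every $j\ge 1$, $\operatorname{Tor}^R_j(N,Z)=0$ implies $\operatorname{Tor}^R_{j+1}(N,Z)=0$. *)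

(* Defs.v *)
From HB Require Import structures.
From mathcomp Require Import all_boot all_order all_algebra.
From mathcomp Require Import boolp.

Set Implicit Arguments.
Unset Strict Implicit.
Unset Printing Implicit Defensive.

Import GRing.Theory.
Local Open Scope ring_scope.
Local Open Scope quotient_scope.

Section Rings.
Variable R : comNzRingType.

Definition generated_ideal (s : seq R) (r : R) : Prop :=
  exists a : 'I_(size s) -> R, r = \sum_i a i * s`_i.

(* An [idealr R] is a proper ideal; the unit ideal is always finitely
   generated, so it can be left out. *)
Definition noetherian : Prop :=
  forall I : idealr R, exists s : seq R,
    forall r, r \in I <-> generated_ideal s r.

Definition maximal_ideal (I : idealr R) : Prop :=
  forall J : idealr R, {subset I <= J} -> {subset J <= I}.

Definition local_ring : Prop :=
  exists2 m : idealr R, maximal_ideal m &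
    forall m' : idealr R, maximal_ideal m' -> m' =i m.

Definition has_prime_chain (l : nat) : Prop :=
  exists P : nat -> prime_idealr R, forall i : nat, (i < l)%N ->
    {subset P i <= P i.+1} /\ ~ {subset P i.+1 <= P i}.

Definition krull_dimension (d : nat) : Prop :=
  has_prime_chain d /\ ~ has_prime_chain d.+1.

Definition regular_sequence (x : seq R) : Prop :=
  (forall i : nat, (i < size x)%N -> forall r : R,
     generated_ideal (take i x) (x`_i * r) -> generated_ideal (take i x) r)
  /\ ~ generated_ideal x 1.

End Rings.

Section FiberProduct.
Variables (S T : comNzRingType) (k : fieldType).
Variables (piS : {rmorphism S -> k}) (piT : {rmorphism T -> k}).

Definition fiber_pred : {pred S * T} := [pred st | piS st.1 == piT st.2].

Fact fiber_subring_closed : subring_closed fiber_pred.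
Proof.
split=> [|u v|u v]; rewrite !inE.
- by rewrite !rmorph1.
- by move=> /eqP eu /eqP ev; rewrite !rmorphB eu ev.
- by move=> /eqP eu /eqP ev; rewrite !rmorphM eu ev.
Qed.

HB.instance Definition _ :=
  GRing.isSubringClosed.Build (S * T)%type fiber_pred fiber_subring_closed.

Record fiber_product := FiberProduct {
  fiber_val :> S * T;
  fiber_valP : fiber_val \in fiber_pred }.

HB.instance Definition _ := [isSub for fiber_val].
HB.instance Definition _ := [Choice of fiber_product by <:].
HB.instance Definition _ :=
  [SubChoice_isSubComNzRing of fiber_product by <:].

End FiberProduct.

(* A surjection of a local ring onto a field has the maximal ideal as its
   kernel, hence is the reduction modulo the maximal ideal. *)
Definition reduction (S : comNzRingType) (k : fieldType)
    (pi : {rmorphism S -> k}) : Prop :=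
  forall c : k, exists s : S, pi s = c.

Definition fiber_product_ring (R : comNzRingType) : Prop :=
  exists (S T : comNzRingType) (k : fieldType)
         (piS : {rmorphism S -> k}) (piT : {rmorphism T -> k}),
    [/\ noetherian S /\ local_ring S, noetherian T /\ local_ring T,
        reduction piS /\ reduction piT,
        ~ injective piS /\ ~ injective piT &
        exists f : {rmorphism R -> fiber_product piS piT}, bijective f].

(* The ideal (x) is proper, so R/(x) is an [ideal_quot] by an [idealr]. *)
Definition quasi_fiber_product_ring (R : comNzRingType) (x : seq R) : Prop :=
  regular_sequence x /\
  exists2 I : idealr R, (forall r, r \in I <-> generated_ideal x r) &
    fiber_product_ring {ideal_quot I}.

Section Modules.
Variable R : comNzRingType.
Implicit Types A B C M N Z : lmodType R.

Definition fin_generated M : Prop :=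
  exists s : seq M, forall v : M,
    exists a : 'I_(size s) -> R, v = \sum_i a i *: s`_i.

Definition nonzero_module M : Prop := exists v : M, v != 0.

Definition exact A B C (f : A -> B) (g : B -> C) : Prop :=
  forall b : B, g b = 0 <-> exists a : A, f a = b.

Definition projective (P : lmodType R) : Prop :=
  forall (A B : lmodType R) (p : {linear A -> B}) (f : {linear P -> B}),
    (forall b : B, exists a : A, p a = b) ->
    exists g : {linear P -> A}, forall u : P, p (g u) = f u.

Definition injective_module (E : lmodType R) : Prop :=
  forall (A B : lmodType R) (j : {linear A -> B}) (f : {linear A -> E}),
    injective j ->
    exists g : {linear B -> E}, forall a : A, g (j a) = f a.

(* ... -> P 2 -> P 1 -> P 0 -> M -> 0, with [proj_diff i : P i.+1 -> P i]. *)
Record proj_resolution M := ProjResolution {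
  proj_term :> nat -> lmodType R;
  proj_diff : forall i, {linear proj_term i.+1 -> proj_term i};
  proj_aug : {linear proj_term 0 -> M};
  proj_termP : forall i, projective (proj_term i);
  proj_aug_surj : forall v : M, exists u, proj_aug u = v;
  proj_exact0 : exact (proj_diff 0) proj_aug;
  proj_exactS : forall i, exact (proj_diff i.+1) (proj_diff i) }.

(* 0 -> N -> E 0 -> E 1 -> E 2 -> ... *)
Record inj_resolution N := InjResolution {
  inj_term :> nat -> lmodType R;
  inj_diff : forall i, {linear inj_term i -> inj_term i.+1};
  inj_aug : {linear N -> inj_term 0};
  inj_termP : forall i, injective_module (inj_term i);
  inj_aug_inj : injective inj_aug;
  inj_exact0 : exact inj_aug (inj_diff 0);
  inj_exactS : forall i, exact (inj_diff i) (inj_diff i.+1) }.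

Definition finite_proj_dim M : Prop :=
  exists (P : proj_resolution M) (l : nat),
    forall i : nat, (l < i)%N -> forall u : P i, u = 0.

Definition finite_inj_dim N : Prop :=
  exists (E : inj_resolution N) (l : nat),
    forall i : nat, (l < i)%N -> forall u : E i, u = 0.

Section Tensor.
Variables M N : lmodType R.

(* A list [:: (m1, n1); ...; (mr, nr)] stands for the tensor
   m1 (x) n1 + ... + mr (x) nr.  Two lists are identified when no bilinear map
   separates them, that is, by the congruence generated by the bilinearity
   relations. *)
Definition bilin_sum (W : lmodType R) (b : {bilinear M -> N -> W})
    (s : seq (M * N)) : W := \sum_(p <- s) b p.1 p.2.

Definition tensor_rel (s t : seq (M * N)) : bool :=
  `[< forall (W : lmodType R) (b : {bilinear M -> N -> W}),
        bilin_sum b s = bilin_sum b t >].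

Fact tensor_rel_refl : reflexive tensor_rel.
Proof. by move=> s; apply/asboolP. Qed.

Fact tensor_rel_sym : symmetric tensor_rel.
Proof. by move=> s t; apply/asboolP/asboolP => h W b; rewrite h. Qed.

Fact tensor_rel_trans : transitive tensor_rel.
Proof.
by move=> t s u /asboolP h1 /asboolP h2; apply/asboolP => W b; rewrite h1.
Qed.

Canonical tensor_equiv :=
  EquivRel tensor_rel tensor_rel_refl tensor_rel_sym tensor_rel_trans.

Definition tensor := {eq_quot tensor_equiv}.
HB.instance Definition _ := Choice.on tensor.
HB.instance Definition _ := EqQuotient.on tensor.

Definition bilin_val (W : lmodType R) (b : {bilinear M -> N -> W})
  (u : tensor) : W := bilin_sum b (repr u).

Lemma bilin_valE (W : lmodType R) (b : {bilinear M -> N -> W}) s :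
  bilin_val b (\pi_tensor s) = bilin_sum b s.
Proof.
by rewrite /bilin_val; case: piP => t /eqquotP/asboolP ->.
Qed.

Lemma tensor_ext (u v : tensor) :
  (forall (W : lmodType R) (b : {bilinear M -> N -> W}),
     bilin_val b u = bilin_val b v) -> u = v.
Proof.
by move=> h; rewrite -[u]reprK -[v]reprK; apply/eqquotP/asboolP => W b; apply: h.
Qed.

Definition tensor_zero : tensor := \pi_tensor [::].
Definition tensor_add (u v : tensor) : tensor :=
  \pi_tensor (repr u ++ repr v).
Definition tensor_scale (a : R) (u : tensor) : tensor :=
  \pi_tensor [seq (a *: p.1, p.2) | p <- repr u].
Definition tensor_opp (u : tensor) : tensor := tensor_scale (-1) u.

Lemma bilin_val0 (W : lmodType R) (b : {bilinear M -> N -> W}) : bilin_val b tensor_zero = 0.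
Proof. by rewrite bilin_valE /bilin_sum big_nil. Qed.

Lemma bilin_valD (W : lmodType R) (b : {bilinear M -> N -> W}) u v :
  bilin_val b (tensor_add u v) = bilin_val b u + bilin_val b v.
Proof. by rewrite bilin_valE /bilin_sum big_cat. Qed.

Lemma bilin_valZ (W : lmodType R) (b : {bilinear M -> N -> W}) a u :
  bilin_val b (tensor_scale a u) = a *: bilin_val b u.
Proof.
rewrite bilin_valE /bilin_sum big_map scaler_sumr.
by apply: eq_bigr => p _; rewrite linearZl_LR.
Qed.

Fact tensor_addA : associative tensor_add.
Proof. by move=> u v w; apply: tensor_ext => W b; rewrite !bilin_valD addrA. Qed.

Fact tensor_addC : commutative tensor_add.
Proof. by move=> u v; apply: tensor_ext => W b; rewrite !bilin_valD addrC. Qed.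

Fact tensor_add0 : left_id tensor_zero tensor_add.
Proof.
by move=> u; apply: tensor_ext => W b; rewrite bilin_valD bilin_val0 add0r.
Qed.

Fact tensor_addN : left_inverse tensor_zero tensor_opp tensor_add.
Proof.
move=> u; apply: tensor_ext => W b.
by rewrite bilin_valD bilin_val0 bilin_valZ scaleN1r addNr.
Qed.

HB.instance Definition _ := GRing.isZmodule.Build tensor
  tensor_addA tensor_addC tensor_add0 tensor_addN.

Fact tensor_scaleA a b u :
  tensor_scale a (tensor_scale b u) = tensor_scale (a * b) u.
Proof. by apply: tensor_ext => W c; rewrite !bilin_valZ scalerA. Qed.

Fact tensor_scale1 : left_id 1 tensor_scale.
Proof. by move=> u; apply: tensor_ext => W c; rewrite bilin_valZ scale1r. Qed.

Fact tensor_scaleDr : right_distributive tensor_scale +%R.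
Proof.
move=> a u v; apply: tensor_ext => W c.
by rewrite !(bilin_valZ, bilin_valD) scalerDr.
Qed.

Fact tensor_scaleDl u : {morph tensor_scale^~ u : a b / a + b}.
Proof.
move=> a b; apply: tensor_ext => W c.
by rewrite !(bilin_valZ, bilin_valD) scalerDl.
Qed.

HB.instance Definition _ := GRing.Zmodule_isLmodule.Build R tensor
  tensor_scaleA tensor_scale1 tensor_scaleDr tensor_scaleDl.

Fact bilin_val_linear (W : lmodType R) (b : {bilinear M -> N -> W}) : linear (bilin_val b).
Proof. by move=> a u v; rewrite bilin_valD bilin_valZ. Qed.

HB.instance Definition _ (W : lmodType R) (b : {bilinear M -> N -> W}) :=
  GRing.isLinear.Build R tensor W *:%R (bilin_val b) (bilin_val_linear b).

Definition pure_tensor (m : M) (n : N) : tensor := \pi_tensor [:: (m, n)].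

Lemma bilin_val_pure (W : lmodType R) (b : {bilinear M -> N -> W}) m n :
  bilin_val b (pure_tensor m n) = b m n.
Proof. by rewrite bilin_valE /bilin_sum big_seq1. Qed.

Fact pure_tensor_bilinear : bilinear_for *:%R *:%R pure_tensor.
Proof.
split=> [n a m m'|m a n n']; apply: tensor_ext => W b.
  by rewrite linearP /= !bilin_val_pure linearPl.
by rewrite linearP /= !bilin_val_pure linearPr.
Qed.

HB.instance Definition _ := bilinear_isBilinear.Build R M N tensor *:%R *:%R
  pure_tensor pure_tensor_bilinear.

Lemma tensor_sum_pure (u : tensor) :
  u = \sum_(p <- repr u) pure_tensor p.1 p.2.
Proof.
apply: tensor_ext => W b; rewrite linear_sum /=.
by apply: eq_bigr => p _; rewrite bilin_val_pure.
Qed.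

Lemma tensor_universal (W : lmodType R) (b : {bilinear M -> N -> W}) :
  exists! g : tensor -> W,
    linear g /\ forall m n, g (pure_tensor m n) = b m n.
Proof.
exists (bilin_val b); split.
  by split=> [|m n]; [exact: bilin_val_linear | exact: bilin_val_pure].
move=> g [glin gE]; apply/funext => u.
pose G := GRing.isLinear.Build R tensor W *:%R g glin.
pose g' : {linear tensor -> W} := HB.pack g G.
rewrite [u]tensor_sum_pure linear_sum -[RHS]/(g' _) linear_sum /=.
by apply: eq_bigr => p _; rewrite bilin_val_pure gE.
Qed.

End Tensor.

Section TensorMap.
Variables (M M' Z : lmodType R) (f : {linear M -> M'}).

Definition tensor_map_pure (m : M) (z : Z) : tensor M' Z :=
  pure_tensor (f m) z.

Fact tensor_map_pure_bilinear : bilinear_for *:%R *:%R tensor_map_pure.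
Proof.
split=> [z a m m'|m a z z']; rewrite /tensor_map_pure.
  by rewrite linearP linearPl.
by rewrite linearPr.
Qed.

HB.instance Definition _ := bilinear_isBilinear.Build R M Z (tensor M' Z)
  *:%R *:%R tensor_map_pure tensor_map_pure_bilinear.

Definition tensor_map : tensor M Z -> tensor M' Z := bilin_val tensor_map_pure.

HB.instance Definition _ := GRing.Linear.on tensor_map.

Lemma tensor_map_pureE m z :
  tensor_map (pure_tensor m z) = pure_tensor (f m) z.
Proof. exact: bilin_val_pure. Qed.

End TensorMap.
Arguments tensor_map {M M'} Z f.

(* Exactness in degree i of the complexes P (x) Z and Hom(P, N), where P is
   deleted, i.e. continued by 0 after degree 0. *)
Definition tensor_acyclic M (P : proj_resolution M) Z (i : nat) : Prop :=
  match i with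
  | 0 => forall u : tensor (P 0) Z,
      exists w, tensor_map Z (proj_diff P 0) w = u
  | j.+1 => exact (tensor_map Z (proj_diff P j.+1))
                  (tensor_map Z (proj_diff P j))
  end.

Definition hom_acyclic M (P : proj_resolution M) N (i : nat) : Prop :=
  forall f : {linear P i -> N},
    (forall u, f (proj_diff P i u) = 0) ->
    match i return ({linear P i -> N} -> Prop) with
    | 0 => fun f => forall u, f u = 0
    | j.+1 => fun f => exists g : {linear P j -> N},
        forall u, f u = g (proj_diff P j u)
    end f.

(* Tor_i(M, Z) = 0 and Ext^i(M, N) = 0; these do not depend on the projective
   resolution from which they are computed. *)
Definition Tor_vanishes (i : nat) M Z : Prop :=
  exists P : proj_resolution M, tensor_acyclic P Z i.

Definition Ext_vanishes (i : nat) M N : Prop :=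
  exists P : proj_resolution M, hom_acyclic P N i.

Definition Tor_rigid N : Prop :=
  forall Z : lmodType R, fin_generated Z -> forall j : nat, (1 <= j)%N ->
    Tor_vanishes j N Z -> Tor_vanishes j.+1 N Z.

End Modules.

Definition gorenstein (R : comNzRingType) : Prop :=
  [/\ noetherian R, local_ring R & finite_inj_dim (R^o : lmodType R)].

(* Main.v *)
From HB Require Import structures.
Require Import Defs.
From mathcomp Require Import all_boot all_order all_algebra.
From mathcomp Require Import fingroup perm generic_quotient boolp ring.

(* Write [Q = R/(x)].  The maximal ideal of [Q] is a direct sum [I (+) J] of
   nonzero ideals, and [Q] has finite injective dimension by Rees' theorem.
   As [I^mu(J)] is a direct summand of the first syzygy of [J], and vice versa,
   a nonzero [Ext^i(I, Q)] with [i >= 1] would propagate to arbitrarily high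
   degrees; hence [Ext^i(I, Q) = Ext^i(J, Q) = 0] for all [i >= 1].  This forces
   [I = (a)] and [J = (b)] with [ann a = J] and [ann b = I].  Over such a ring,
   each map in a minimal exact complex of free modules that is followed by a
   nonzero one sends some unimodular row into [a F] or into [b F], with
   the two cases alternating; playing two complexes against each other gives a
   nonzero Tor in high degree unless one of the complexes stops.

   Over [R], put [D_i] for the transpose of the [i]-th syzygy of [M].  The
   vanishing of [Ext^i(M, N)] gives that of [Tor_1(D_i, N)], hence by rigidity
   that of all [Tor_j(D_i, N)], and then [Ext^i(M, R) = 0] by Nakayama.  For
   [t <= i <= t + n] this makes [D_t] an [n]-th syzygy of [D_(t+n)], so that
   the minimal resolution of [D_(t+n)] passes through the dual of
   [F_(t+1) -> F_t -> F_(t-1)] in degree [n], from where on it remains exact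
   modulo [(x)].  The previous paragraph applies to it and to the minimal
   resolution of [N]. *)

Set Implicit Arguments.
Unset Strict Implicit.
Unset Printing Implicit Defensive.

Import GRing.Theory.
Local Open Scope ring_scope.
Local Open Scope quotient_scope.

(** * Exact complexes and quotients by a regular element *)

Lemma choice_dep (I : Type) (T : I -> Type) (P : forall i, T i -> Prop) :
  (forall i, exists t, P i t) -> exists f : forall i, T i, forall i, P i (f i).
Proof.
by move=> ex; exists (fun i => projT1 (cid (ex i))) => i; case: (cid _).
Qed.

Section ExactMatrices.
Variable R : comNzRingType.

(** Exactness is tested on matrices with any number of rows at once, so that a lift is a single
    matrix equation; [exm_row] reduces this to row vectors. *)
Definition exm p q s (A' : 'M[R]_(p, q)) (A : 'M[R]_(q, s)) : Prop :=
  A' *m A = 0 /\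
  forall k (U : 'M_(k, q)), U *m A = 0 -> exists V : 'M_(k, p), U = V *m A'.

Lemma mulmx_rowwise k p q (U : 'M[R]_(k, q)) (A : 'M[R]_(p, q)) :
  (forall i, exists v : 'rV_p, row i U = v *m A) -> exists V, U = V *m A.
Proof.
move=> /choice[f fE]; exists (\matrix_i f i).
by apply/row_matrixP => i; rewrite row_mul rowK.
Qed.

Lemma exm_row p q s (A' : 'M[R]_(p, q)) (A : 'M[R]_(q, s)) :
  (forall u : 'rV_q, u *m A = 0 <-> exists v : 'rV_p, u = v *m A') ->
  exm A' A.
Proof.
move=> ex; split=> [|k U UA].
  apply/row_matrixP => i; rewrite row_mul row0; apply/ex.
  by exists (delta_mx 0 i); rewrite -rowE.
apply: mulmx_rowwise => i; apply/ex.
by rewrite -row_mul UA row0.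
Qed.

(** This is the row condition read for [U^T]. It is not exactness of the dual complex, where the
    transposed matrices would act on row vectors. *)
Lemma exm_tr p q s (A' : 'M[R]_(p, q)) (A : 'M[R]_(q, s)) k (U : 'M_(q, k)) :
  exm A' A -> A^T *m U = 0 -> exists V, U = A'^T *m V.
Proof.
move=> [_ ex] AU; have [|V UE] := ex k U^T.
  by rewrite -[A]trmxK -trmx_mul AU trmx0.
by exists V^T; rewrite -[U]trmxK UE trmx_mul.
Qed.

(* Matrices act on row vectors: [A i] is the map [F_(i+1) -> F_i] of a complex
   of free modules with [F_i] of rank [r i]. *)
Definition exact_from (k : nat) (r : nat -> nat)
    (A : forall i, 'M[R]_(r i.+1, r i)) : Prop :=
  forall i, (k <= i)%N -> exm (A i.+1) (A i).

(* [U] represents an element of [F_(i+1) (x) G_l], where [F] and [G] are the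
   complexes of [A] and [B]; the condition is [Tor_(i+1)(coker A_0, W) = 0] for
   the [l]-th syzygy [W] of [coker B_0]. *)
Definition tor_from (k : nat) (r s : nat -> nat)
    (A : forall i, 'M[R]_(r i.+1, r i)) (B : forall i, 'M[R]_(s i.+1, s i)) :
    Prop :=
  forall i l, (k <= i)%N -> (k <= l)%N ->
  forall (U : 'M_(r i.+1, s l)) (V : 'M_(r i, s l.+1)),
    (A i)^T *m U = V *m B l ->
    exists W V', U = (A i.+1)^T *m W + V' *m B l.

(* [Ext^(j+1)(-, R) = 0] for [j >= l]. *)
Definition dual_exact_from (l : nat) : Prop :=
  forall (r : nat -> nat) (A : forall i, 'M[R]_(r i.+1, r i)),
  exact_from 0 A -> forall j, (l <= j)%N ->
  forall phi : 'cV_(r j.+1), A j.+1 *m phi = 0 -> exists psi, phi = A j *m psi.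

End ExactMatrices.

Section RegularQuotient.
Variables (R R' : comNzRingType) (pi : {rmorphism R -> R'}) (x : R).
Hypothesis pi_surj : forall y, exists r, pi r = y.
Hypothesis pi_ker : forall r, pi r = 0 <-> exists s, r = x * s.
Hypothesis x_reg : forall r, x * r = 0 -> r = 0.

Lemma map_mx_lift p q (B : 'M[R']_(p, q)) : exists A, map_mx pi A = B.
Proof.
have /choice[f fE] : forall ij : 'I_p * 'I_q, exists r, pi r = B ij.1 ij.2.
  by move=> ij; apply: pi_surj.
by exists (\matrix_(i, j) f (i, j)); apply/matrixP => i j; rewrite !mxE fE.
Qed.

Lemma map_mx_ker p q (A : 'M[R]_(p, q)) :
  map_mx pi A = 0 -> exists H, A = x *: H.
Proof.
move=> /matrixP A0; have /choice[f fE] : forall ij : 'I_p * 'I_q,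
    exists s, A ij.1 ij.2 = x * s.
  by move=> ij; apply/pi_ker; have := A0 ij.1 ij.2; rewrite !mxE.
exists (\matrix_(i, j) f (i, j)); apply/matrixP => i j.
by rewrite !mxE (fE (i, j)).
Qed.

Lemma pi_x : pi x = 0.
Proof. by apply/pi_ker; exists 1; rewrite mulr1. Qed.

Lemma map_mx_eq p q (A B : 'M[R]_(p, q)) :
  map_mx pi A = map_mx pi B -> exists H, A = B + x *: H.
Proof.
move=> e; have [|H HE] := @map_mx_ker _ _ (A - B).
  by rewrite map_mxB e subrr.
by exists H; rewrite -HE addrC subrK.
Qed.

Lemma scale_mx_reg p q (A : 'M[R]_(p, q)) : x *: A = 0 -> A = 0.
Proof.
move=> /matrixP A0; apply/matrixP => i j; have := A0 i j; rewrite !mxE.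
exact: x_reg.
Qed.

(** A cycle modulo [x] lifts to [U] with [U *m A1 = x *: w]. As [x] is regular, [w] is a cycle,
    hence [w = v *m A1], and [U - x *: v] is a cycle over [R]. Exactness one place further down is
    consumed, as in the long exact sequence of multiplication by [x]. *)
Lemma exm_quotient p q s t (A2 : 'M[R]_(p, q)) (A1 : 'M[R]_(q, s))
    (A0 : 'M[R]_(s, t)) :
  exm A2 A1 -> exm A1 A0 -> exm (map_mx pi A2) (map_mx pi A1).
Proof.
move=> [z2 e2] [z1 e1]; split; first by rewrite -map_mxM z2 map_mx0.
move=> k U'; have [U <-] := map_mx_lift U'; rewrite -map_mxM.
move=> /map_mx_ker[w UE].
have [|v wE] := e1 _ w.
  apply: scale_mx_reg.
  by rewrite -(mul0mx _ A0) scalemxAl -UE -mulmxA z1 mulmx0 mul0mx.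
have [|V VE] := e2 _ (U - x *: v).
  by rewrite mulmxBl UE wE scalemxAl subrr.
exists (map_mx pi V).
by rewrite -map_mxM -VE map_mxB map_mxZ pi_x scale0r subr0.
Qed.

Lemma exact_from_quotient k r (A : forall i, 'M[R]_(r i.+1, r i)) :
  exact_from k A -> exact_from k.+1 (fun i => map_mx pi (A i)).
Proof.
move=> ex [//|i] ki; apply: (@exm_quotient _ _ _ _ _ _ (A i)).
  by apply: ex; apply: leqW.
exact: ex.
Qed.

(** A cycle modulo [x] satisfies its equation up to an error [x *: w]. The error [w] is a cycle one
    degree lower, hence a boundary by the vanishing of Tor there; absorbing it into [U] and [V]
    gives a cycle over [R]. *)
Lemma tor_from_quotient k r s (A : forall i, 'M[R]_(r i.+1, r i))
    (B : forall i, 'M[R]_(s i.+1, s i)) :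
  exact_from k A -> exact_from k B -> tor_from k A B ->
  tor_from k.+1 (fun i => map_mx pi (A i)) (fun i => map_mx pi (B i)).
Proof.
move=> exA exB tor [//|i] [//|l]; rewrite !ltnS => ki kl U' V'.
have [U <-] := map_mx_lift U'; have [V <-] := map_mx_lift V'.
rewrite map_trmx -!map_mxM => /map_mx_eq[w UE].
have [zA _] := exA i ki.
have [_ exB'] : exm (map_mx pi (B l.+2)) (map_mx pi (B l.+1)).
  by apply: (exact_from_quotient exB).
have zA' : (A i)^T *m (A i.+1)^T = 0 by rewrite -trmx_mul zA trmx0.
(* The reduction of [(A i)^T *m V] is a cycle of [B] modulo [x], so
   [(A i)^T *m V = Y *m B l.+2 + x *: Y']. Cancelling [x] then gives
   [(A i)^T *m w = - Y' *m B l.+1]. *)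
have [|Y0] := exB' _ (map_mx pi ((A i)^T *m V)).
  rewrite -map_mxM -mulmxA; apply/eqP; rewrite -subr_eq0 subr0; apply/eqP.
  have -> : V *m B l.+1 = (A i.+1)^T *m U - x *: w by rewrite UE addrK.
  rewrite mulmxBr mulmxA zA' mul0mx sub0r -scalemxAr.
  by rewrite map_mxN map_mxZ pi_x scale0r oppr0.
have [Y <-] := map_mx_lift Y0; rewrite -map_mxM => /map_mx_eq[Y' YE].
have [|W1 [V1 wE]] := tor i l.+1 ki (leqW kl) w (- Y').
  apply/eqP; rewrite -subr_eq0; apply/eqP; apply: scale_mx_reg.
  have := congr1 (mulmx (A i)^T) UE; rewrite mulmxA zA' mul0mx mulmxDr mulmxA YE.
  rewrite mulmxDl -mulmxA (exB l.+1 (leqW kl)).1 mulmx0 add0r.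
  rewrite -scalemxAr -scalemxAl => /eqP; rewrite eq_sym addrC => /eqP.
  by rewrite mulNmx opprK scalerDr.
have [||W2 [V2 E2]] := tor i.+1 l.+1 _ (leqW kl) (U - x *: W1) (V + x *: V1).
- exact: leqW.
- rewrite mulmxBr UE wE scalerDr mulmxDl -!scalemxAl -!scalemxAr.
  by rewrite [x *: _ + x *: _]addrC addrA addrK.
exists (map_mx pi W2), (map_mx pi V2).
by rewrite map_trmx -!map_mxM -map_mxD -E2 map_mxB map_mxZ pi_x scale0r subr0.
Qed.

(* Rees' change of rings.  If [A] lifts an exact complex over [R'], then
   [A i.+1 *m A i = x *: H i], and the mapping cone of [x] with homotopy [H]
   is an exact complex over [R] for the same module. *)
Lemma dual_exact_from_quotient l : dual_exact_from R l -> dual_exact_from R' l.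
Proof.
move=> idR r A' exA'.
have /choice_dep[A AE] : forall i, exists A, map_mx pi A = A' i.
  by move=> i; apply: map_mx_lift.
have /choice_dep[H HE] : forall i, exists H, A i.+1 *m A i = x *: H.
  move=> i; apply: map_mx_ker; rewrite map_mxM !AE.
  by case: (exA' i).
have HA i : H i.+1 *m A i = A i.+2 *m H i.
  apply/eqP; rewrite -subr_eq0; apply/eqP; apply: scale_mx_reg.
  by rewrite scalerBr scalemxAl -HE scalemxAr -HE mulmxA subrr.
pose D i : 'M[R]_(r i.+2 + r i.+1, r i.+1 + r i) :=
  block_mx (A i.+1) (- H i) x%:M (- A i).
have exD : exact_from 0 D.
  move=> i _; split=> [|k U].
    rewrite mulmx_block !mulNmx !mulmxN !mul_mx_scalar !mul_scalar_mx !HE.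
    by rewrite !opprK HA !(subrr, addNr) block_mx0.
  rewrite -[U]hsubmxK; set u := lsubmx U; set v := rsubmx U.
  rewrite mul_row_block mul_mx_scalar.
  rewrite -[X in _ = X]row_mx0 => /eq_row_mx[e1 e2].
  have [_ exAi] := exA' i.+1 isT.
  have [|w0] := exAi _ (map_mx pi u).
    rewrite -AE -map_mxM (_ : u *m _ = - (x *: v)).
      by rewrite map_mxN map_mxZ pi_x scale0r oppr0.
    by apply/eqP; rewrite -addr_eq0 e1.
  have [w <-] := map_mx_lift w0; rewrite -AE -map_mxM => /map_mx_eq[w' uE].
  exists (row_mx w w'); rewrite mul_row_block mul_mx_scalar -uE !mulmxN.
  congr row_mx; apply/eqP; rewrite -subr_eq0; apply/eqP; apply: scale_mx_reg.
  move: e1; rewrite uE mulmxDl -mulmxA HE -scalemxAr -scalemxAl -!scalerDr.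
  by move=> e; rewrite -[RHS]e; congr (_ *: _); rewrite opprD !opprK addrC.
move=> j lj phi'; have [phi <-] := map_mx_lift phi'.
rewrite -AE -map_mxM => /map_mx_ker[w phiE].
(* The cocycle [phi'] lifts to the cocycle [(w, phi)] of the cone. The lower block of its primitive
   expresses [phi] as [- A j] applied to a column, modulo [x]. *)
have [|psi psiE] := idR _ D exD j lj (col_mx w phi).
  rewrite mul_block_col mul_scalar_mx !mulNmx phiE subrr.
  rewrite (_ : A _ *m w = H j.+1 *m phi) ?subrr ?col_mx0 //.
  apply/eqP; rewrite -subr_eq0; apply/eqP; apply: scale_mx_reg.
  by rewrite scalerBr scalemxAr -phiE scalemxAl -HE mulmxA subrr.
move: psiE; rewrite -[psi]vsubmxK mul_block_col => /eq_col_mx[_ ->].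
exists (map_mx pi (- dsubmx psi)).
rewrite -AE -map_mxM mul_scalar_mx map_mxD map_mxZ pi_x scale0r add0r.
by rewrite mulNmx mulmxN.
Qed.

End RegularQuotient.

(** * Local Noetherian rings and minimal resolutions *)

Section Units.
Variable R : comNzRingType.

Definition invertible (r : R) : Prop := exists s, r * s = 1.
Definition nonunit (r : R) : Prop := ~ invertible r.
(** Locality in elementary form: with [nonunitMl] it makes the nonunits an ideal, the maximal
    one. *)
Definition nonunits_closed : Prop :=
  forall r s, nonunit r -> nonunit s -> nonunit (r + s).

Lemma nonunit0 : nonunit 0.
Proof. by move=> [s /eqP]; rewrite mul0r eq_sym oner_eq0. Qed.

Lemma nonunitMl r s : nonunit s -> nonunit (r * s).
Proof. by move=> ns [t e]; apply: ns; exists (r * t); rewrite mulrCA mulrA. Qed.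

Lemma nonunitMr r s : nonunit r -> nonunit (r * s).
Proof. by rewrite mulrC; apply: nonunitMl. Qed.

Lemma nonunitN r : nonunit r -> nonunit (- r).
Proof. by rewrite -mulN1r; apply: nonunitMl. Qed.

Lemma invertibleM r s : invertible r -> invertible s -> invertible (r * s).
Proof. by move=> [t e] [u e']; exists (t * u); rewrite mulrACA e e' mulr1. Qed.

Lemma invertible1 : invertible 1.
Proof. by exists 1; rewrite mulr1. Qed.

Lemma invertible_cancel r s : invertible r -> r * s = 0 -> s = 0.
Proof.
by move=> [t e] rs; rewrite -[s]mul1r -e mulrAC rs mul0r.
Qed.

Definition mx_nonunit p q (A : 'M[R]_(p, q)) : Prop :=
  forall i j, nonunit (A i j).

(** Over a local ring the entries of a row generate the unit ideal exactly when one of them is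
    invertible. *)
Definition unimodular q (u : 'rV[R]_q) : Prop := exists j, invertible (u 0 j).

Hypothesis loc : nonunits_closed.

Lemma nonunit_sum (I : Type) (s : seq I) (P : pred I) (F : I -> R) :
  (forall i, P i -> nonunit (F i)) -> nonunit (\sum_(i <- s | P i) F i).
Proof. by move=> F0; apply: big_ind => //; exact: nonunit0. Qed.

Lemma invertible_1B r : nonunit r -> invertible (1 - r).
Proof.
move=> nr; apply: contrapT => n1; have := loc n1 nr.
by rewrite subrK; apply; exact: invertible1.
Qed.

Lemma mx_nonunitMl p q s (A : 'M[R]_(p, q)) (B : 'M_(q, s)) :
  mx_nonunit B -> mx_nonunit (A *m B).
Proof.
by move=> B0 i j; rewrite mxE; apply: nonunit_sum => k _; apply: nonunitMl.
Qed.

Lemma mx_nonunitMr p q s (A : 'M[R]_(p, q)) (B : 'M_(q, s)) :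
  mx_nonunit A -> mx_nonunit (A *m B).
Proof.
by move=> A0 i j; rewrite mxE; apply: nonunit_sum => k _; apply: nonunitMr.
Qed.

Lemma mx_nonunitD p q (A B : 'M[R]_(p, q)) :
  mx_nonunit A -> mx_nonunit B -> mx_nonunit (A + B).
Proof. by move=> A0 B0 i j; rewrite mxE; apply: loc. Qed.

Lemma mx_nonunit_tr p q (A : 'M[R]_(p, q)) : mx_nonunit A -> mx_nonunit A^T.
Proof. by move=> A0 i j; rewrite mxE. Qed.

(* Every term of the Leibniz formula except the diagonal one is a nonunit. *)
Lemma one_plus_nonunit_inv n (Y : 'M[R]_n) :
  mx_nonunit (Y - 1%:M) -> exists G, Y *m G = 1%:M.
Proof.
move=> Y1; suff [d dE] : invertible (\det Y).
  by exists (\adj Y *m d%:M); rewrite mulmxA mul_mx_adj -scalar_mxM dE.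
have Yd i : invertible (Y i i).
  have /nonunitN/invertible_1B := Y1 i i.
  by rewrite !mxE eqxx mulr1n opprK [1 + _]addrC subrK.
have Yo (i j : 'I_n) : i != j -> nonunit (Y i j).
  by move=> /negPf ij; have := Y1 i j; rewrite !mxE ij subr0.
rewrite /determinant (bigD1 (1%g : 'S_n)) //= odd_perm1 mul1r.
apply: contrapT => nd.
have := @loc _ (- \sum_(s : 'S_n | s != 1%g) (-1) ^+ s * \prod_i Y i (s i)) nd.
rewrite addrK; apply.
  apply: nonunitN; apply: nonunit_sum => s s1.
  have [i si] : exists i, i != s i.
    apply: contrapT => ni; move/eqP: s1; apply; apply/permP => i.
    rewrite perm1; apply: contrapT => si; apply: ni; exists i.
    by rewrite eq_sym; apply/eqP.
  by rewrite (bigD1 i) //=; apply/nonunitMl/nonunitMr/Yo.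
apply: big_ind => [|a b|i _].
- exact: invertible1.
- exact: invertibleM.
- by rewrite perm1.
Qed.

End Units.

Section Generators.
Variables (R : comNzRingType) (V : lmodType R).

Definition lincomb m (s : 'I_m -> V) (v : 'rV[R]_m) : V :=
  \sum_i v 0 i *: s i.

Fact lincomb_linear m (s : 'I_m -> V) : linear (lincomb s).
Proof.
move=> a u v; rewrite /lincomb scaler_sumr -big_split; apply: eq_bigr => i _.
by rewrite !mxE scalerDl scalerA.
Qed.

HB.instance Definition _ m (s : 'I_m -> V) :=
  GRing.isLinear.Build R 'rV[R]_m V *:%R (lincomb s) (@lincomb_linear m s).

Definition generates (P : V -> Prop) m (s : 'I_m -> V) : Prop :=
  forall w, P w <-> exists v, w = lincomb s v.

(** Take a generating family of least length: a relation with an invertible coefficient would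
    express one generator by the others, which could then be dropped. *)
Lemma minimal_generators (P : V -> Prop) :
  (exists m (s : 'I_m -> V), generates P s) ->
  exists m (s : 'I_m -> V), generates P s /\
    forall v, lincomb s v = 0 -> mx_nonunit v.
Proof.
move=> [m0 [s0 gs0]].
have /ex_minnP[m /asboolP[s gs] mmin] :
    exists m, `[< exists s : 'I_m -> V, generates P s >].
  by exists m0; apply/asboolP; exists s0.
exists m, s; split=> // v sv i j; rewrite ord1 {i} => -[t vt].
case: m => [|m] in s gs mmin v sv j vt *; first by case: j vt => [].
suff : (m < m)%N by rewrite ltnn.
apply: mmin; apply/asboolP; exists (s \o lift j) => w; rewrite gs.
have split_sum (u : 'rV_m.+1) :
    lincomb s u = u 0 j *: s j + \sum_i u 0 (lift j i) *: s (lift j i).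
  by rewrite /lincomb (bigD1_ord j).
have sjE : s j = - (t *: \sum_i v 0 (lift j i) *: s (lift j i)).
  apply/eqP; rewrite -addr_eq0 -[s j]scale1r -vt mulrC -scalerA -scalerDr.
  by rewrite -split_sum sv scaler0.
split=> -[u ->].
  exists (\row_i (u 0 (lift j i) - u 0 j * t * v 0 (lift j i))).
  rewrite split_sum sjE scalerN scalerA addrC scaler_sumr -sumrB.
  by apply: eq_bigr => i _; rewrite mxE scalerBl scalerA.
exists (\row_i if unlift j i is Some i' then u 0 i' else 0).
rewrite split_sum mxE unlift_none scale0r add0r; apply: eq_bigr => i _.
by rewrite mxE liftK.
Qed.

End Generators.

Section Noetherian.
Variable R : comNzRingType.

Definition submodule (V : lmodType R) (P : V -> Prop) : Prop :=
  [/\ P 0, forall u v, P u -> P v -> P (u + v) & forall a u, P u -> P (a *: u)].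

Definition ideal_pred (P : R -> Prop) : Prop :=
  [/\ P 0, forall u v, P u -> P v -> P (u + v) & forall a u, P u -> P (a * u)].

Definition ideal_generators (P : R -> Prop) m (a : 'cV[R]_m) : Prop :=
  forall y, P y <-> exists u : 'rV_m, y = (u *m a) 0 0.

Definition ideals_fg : Prop :=
  forall P : R -> Prop, ideal_pred P -> exists m (a : 'cV_m), ideal_generators P a.

(** Induction on [n]. The first coordinates of [P] form an ideal, whose generators are lifted to the
    vectors [d]; the vectors of [P] with first coordinate 0 form a submodule of a free module of
    smaller rank, generated by [e]. *)
Lemma rV_submodule_fg : ideals_fg -> forall n (P : 'rV[R]_n -> Prop),
  submodule P -> exists m (s : 'I_m -> 'rV[R]_n), generates P s.
Proof.
move=> fg; elim=> [|n IHn] P [P0 PD PZ].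
  exists 0%N, (fun=> 0) => w; rewrite (thinmx0 w); split=> // _.
  by exists 0; rewrite linear0.
have [|m1 [c cE]] := fg (fun y => exists2 u, P u & u 0 0 = y).
  split; first by exists 0 => //; rewrite mxE.
    by move=> _ _ [u Pu <-] [v Pv <-]; exists (u + v); [apply: PD|rewrite mxE].
  by move=> a _ [u Pu <-]; exists (a *: u); [apply: PZ|rewrite mxE].
have /choice[d dP] : forall i, exists u : 'rV_n.+1, P u /\ u 0 0 = c i 0.
  move=> i; have [|u Pu e] := (cE (c i 0)).2; last by exists u.
  by exists (delta_mx 0 i); rewrite -rowE mxE.
have [|m2 [e eE]] := IHn (fun u => P (row_mx (0 : 'M_1) u)).
  split; first by rewrite row_mx0.
    by move=> u v Pu Pv; rewrite -[0]addr0 -add_row_mx; apply: PD.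
  by move=> a u Pu; rewrite -[0](scaler0 _ a) -scale_row_mx; apply: PZ.
pose s (i : 'I_(m1 + m2)) : 'rV[R]_n.+1 :=
  match split i with inl j => d j | inr j => row_mx (0 : 'M_1) (e j) end.
have sE v : lincomb s v =
    lincomb d (lsubmx v) + row_mx (0 : 'M_1) (lincomb e (rsubmx v)).
  rewrite /lincomb big_split_ord /=; congr (_ + _).
    by apply: eq_bigr => i _; rewrite /s (unsplitK (inl _ i)) mxE.
  rewrite (eq_bigr (fun i => row_mx (0 : 'M_1) (rsubmx v 0 i *: e i))).
    symmetry; apply: (big_morph (fun u => row_mx (0 : 'M[R]_1) u)) => [a b|].
      by rewrite (add_row_mx (0 : 'M_1) a 0 b) addr0.
    by rewrite row_mx0.
  move=> i _; rewrite /s (unsplitK (inr _ i)) mxE.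
  by rewrite (scale_row_mx _ (0 : 'M_1)) scaler0.
have Pd v : P (lincomb d v).
  by apply: big_ind => // i _; apply: PZ; case: (dP i).
exists (m1 + m2)%N, s => w; split=> [Pw|[v ->]]; last first.
  by rewrite sE; apply: PD => //; apply/eE; exists (rsubmx v).
have [v vE] := (cE (w 0 0)).1 (ex_intro2 _ _ w Pw erefl).
pose z : 'rV[R]_(1 + n) := w - lincomb d v.
have z0 : z = row_mx (0 : 'M_1) (rsubmx z).
  rewrite -{1}[z]hsubmxK; congr row_mx.
  apply/rowP => j; rewrite !mxE [j]ord1.
  rewrite (_ : lshift n (0 : 'I_1) = (0 : 'I_n.+1)); last exact: val_inj.
  rewrite vE /lincomb summxE mxE -sumrB big1 // => i _.
  by rewrite mxE (dP i).2 subrr.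
have [|u uE] := (eE (rsubmx z)).1.
  rewrite -z0; apply: PD => //.
  by rewrite -scaleN1r; apply: PZ.
exists (row_mx v u); rewrite sE row_mxKl row_mxKr -uE -z0.
by rewrite addrC subrK.
Qed.

Lemma lincomb_mulmx m n (s : 'I_m -> 'rV[R]_n) v :
  lincomb s v = v *m \matrix_i s i.
Proof.
by rewrite mulmx_sum_row; apply: eq_bigr => i _; rewrite rowK.
Qed.

Hypothesis fg : ideals_fg.

Lemma minimal_syzygies (W : lmodType R) n (f : {linear 'rV[R]_n -> W}) :
  exists m (S : 'M[R]_(m, n)),
    (forall u, f u = 0 <-> exists v, u = v *m S) /\
    forall v : 'rV_m, v *m S = 0 -> mx_nonunit v.
Proof.
have [|m [s [gs smin]]] := @minimal_generators _ _ (fun u => f u = 0).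
  apply: rV_submodule_fg => //; split; first exact: linear0.
    by move=> u v fu fv; rewrite linearD fu fv addr0.
  by move=> a u fu; rewrite linearZ /= fu scaler0.
exists m, (\matrix_i s i); split=> [u|v].
  by rewrite gs; split=> -[v ->]; exists v; rewrite lincomb_mulmx.
by rewrite -lincomb_mulmx; apply: smin.
Qed.

(** Minimal syzygies are iterated. [A0] may contain units, since [f] is not assumed to come from
    minimal generators; from [A 0] on, the rows are relations between minimal generators. *)
Lemma resolution_exists (W : lmodType R) n (f : {linear 'rV[R]_n -> W}) :
  exists r (A0 : 'M[R]_(r 0%N, n)) (A : forall i, 'M[R]_(r i.+1, r i)),
    [/\ forall u, f u = 0 <-> exists v, u = v *m A0,
        exm (A 0%N) A0, exact_from 0 A & forall i, mx_nonunit (A i)].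
Proof.
(* The sizes vary along the resolution, so each stage is a matrix packed with its two sizes. *)
pose T := {m : nat & {n : nat & 'M[R]_(m, n)}}.
have /choice_dep[next nextP] : forall D : T, exists m,
    exists S : 'M[R]_(m, projT1 D), exm S (projT2 (projT2 D)) /\
      forall v : 'rV_m, v *m S = 0 -> mx_nonunit v.
  move=> D; have [m [S [S1 S2]]] := minimal_syzygies (mulmxr (projT2 (projT2 D))).
  by exists m, S; split=> //; apply: exm_row.
have [K KP] := choice_dep nextP.
have [m [S [S1 S2]]] := minimal_syzygies f.
pose st := fix st i : T := if i is j.+1 then
  existT _ (next (st j)) (existT _ (projT1 (st j)) (K (st j)))
  else existT _ m (existT _ n S).
pose r i := projT1 (st i).
have ex0 i : exm (K (st i)) (projT2 (projT2 (st i))) by case: (KP (st i)).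
have mini i (v : 'rV_(r i)) : v *m projT2 (projT2 (st i)) = 0 -> mx_nonunit v.
  by case: i v => [|i] v; [apply: S2|case: (KP (st i)) => _; apply].
exists r, S, (fun i => K (st i)); split=> //.
- exact: (ex0 0%N).
- by move=> i _; exact: (ex0 i.+1).
- move=> i p q; have := mini i (row p (K (st i))).
  by rewrite -row_mul (ex0 i).1 row0 => /(_ erefl) /(_ 0 q); rewrite mxE.
Qed.

Lemma ideal_minimal_generators (P : R -> Prop) : ideal_pred P ->
  exists m (a : 'cV[R]_m), ideal_generators P a /\
    forall u : 'rV_m, u *m a = 0 -> mx_nonunit u.
Proof.
move=> /fg[m0 [a0 ga0]].
have aE m (s : 'I_m -> R^o) u : lincomb s u = (u *m \col_i (s i : R)) 0 0.
  by rewrite mxE; apply: eq_bigr => i _; rewrite mxE.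
have [|m [s [gs smin]]] := @minimal_generators R R^o P.
  exists m0, (fun i => a0 i 0) => y; rewrite ga0; split=> -[u ->]; exists u;
    by rewrite mxE; apply: eq_bigr.
exists m, (\col_i (s i : R)); split=> [y|u ua].
  by rewrite gs; split=> -[u ->]; exists u; rewrite aE.
by apply: smin; rewrite aE ua mxE.
Qed.

Lemma ideals_acc (P : nat -> R -> Prop) :
  (forall k, ideal_pred (P k)) -> (forall k y, P k y -> P k.+1 y) ->
  exists k, forall j y, P j y -> P k y.
Proof.
move=> idP incP.
have mono k j y : (k <= j)%N -> P k y -> P j y.
  move=> /subnKC <-; elim: (j - k)%N => [|d IHd]; first by rewrite addn0.
  by rewrite addnS => /IHd/incP.
have [|m [a ga]] := fg (P := fun y => exists k, P k y).
  split; first by exists 0%N; case: (idP 0%N).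
    move=> u v [k Pu] [j Pv]; exists (maxn k j).
    by case: (idP (maxn k j)) => _ D _; apply: D;
      [apply: mono Pu; apply: leq_maxl|apply: mono Pv; apply: leq_maxr].
  by move=> c u [k Pu]; exists k; case: (idP k) => _ _; apply.
have /choice[k kP] : forall i, exists k, P k (a i 0).
  by move=> i; apply/ga; exists (delta_mx 0 i); rewrite -rowE mxE.
exists (\max_i k i)%N => j y Py.
have [|v ->] := (ga y).1; first by exists j.
case: (idP (\max_i k i)%N) => P0 PD PZ; rewrite mxE; apply: big_ind => // i _.
by apply: PZ; apply: mono (kP i); apply: leq_bigmax.
Qed.

End Noetherian.

Lemma ideals_fg_quotient (R R' : comNzRingType) (pi : {rmorphism R -> R'}) :
  (forall y, exists r, pi r = y) -> ideals_fg R -> ideals_fg R'.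
Proof.
move=> surj fg P [P0 PD PZ].
have [|m [a ga]] := fg (fun r => P (pi r)).
  split; first by rewrite rmorph0.
    by move=> u v; rewrite rmorphD; apply: PD.
  by move=> c u; rewrite rmorphM; apply: PZ.
exists m, (map_mx pi a) => w; split=> [|[v ->]].
  have [r <-] := surj w => /ga[v ->]; exists (map_mx pi v).
  by rewrite -map_mxM [RHS]mxE.
rewrite mxE; apply: (big_ind P) => // i _; apply: PZ; rewrite mxE.
apply/(ga (a i 0)).
by exists (delta_mx 0 i); rewrite -rowE mxE.
Qed.

(** * Rings whose maximal ideal is the sum of two lines *)

Section TwoLines.
Variable R : comNzRingType.

(** The maximal ideal is the direct sum of the lines [R a] and [R b], and each line is the
    annihilator of the generator of the other, as in [k[[a, b]]/(a b)]. *)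
Definition two_lines (a b : R) : Prop :=
  [/\ [/\ a != 0, b != 0 & a * b = 0],
      forall r, nonunit r -> exists s t, r = a * s + b * t,
      forall r, a * r = 0 -> exists s, r = b * s,
      forall r, b * r = 0 -> exists s, r = a * s &
      forall s t, a * s = b * t -> a * s = 0].

Lemma two_linesC a b : two_lines a b -> two_lines b a.
Proof.
move=> [[a0 b0 ab] dec anna annb disj]; split=> //; first by rewrite mulrC.
  by move=> r /dec[s [t ->]]; exists t, s; rewrite addrC.
by move=> s t e; rewrite e; apply: disj (esym e).
Qed.

(** Over a local ring a unimodular [k] belongs to a basis, so after a change of basis of its source
    [A] has a row divisible by [a]. *)
Definition divides_row (a : R) p q (A : 'M[R]_(p, q)) : Prop :=
  exists2 k : 'rV_p, unimodular k & exists w, k *m A = a *: w.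

Section OneLine.
Variables a b : R.
Hypotheses (loc : nonunits_closed R) (fg : ideals_fg R) (ab2 : two_lines a b).

Lemma two_lines_nonunit : nonunit a /\ nonunit b.
Proof.
case: ab2 => -[a0 b0 ab] _ _ _ _; split.
  by move=> /invertible_cancel/(_ ab)/eqP; apply/negP.
by move: ab; rewrite mulrC => ba /invertible_cancel/(_ ba)/eqP; apply/negP.
Qed.

(** Powers of [a] have the annihilator of [a]: an element of [R a] killed by [a] lies in both lines,
    hence is 0. *)
Lemma two_lines_annX e r : a ^+ e.+1 * r = 0 -> exists s, r = b * s.
Proof.
case: ab2 => _ _ anna _ disj; elim: e => [|e IHe]; first by apply: anna.
rewrite exprS -mulrA => h; have [s hs] := anna _ h; apply: IHe.
by rewrite exprS -mulrA; apply: disj (s) _; rewrite mulrA -exprS.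
Qed.

Lemma two_lines_decomp q (u : 'rV[R]_q) :
  mx_nonunit u -> exists u1 u2, u = a *: u1 + b *: u2.
Proof.
case: ab2 => _ dec _ _ _ u0.
have /choice[f fE] : forall j, exists st, u 0 j = a * st.1 + b * st.2.
  by move=> j; have [s [t e]] := dec _ (u0 0 j); exists (s, t).
exists (\row_j (f j).1), (\row_j (f j).2).
by apply/rowP => j; rewrite !mxE fE.
Qed.

Lemma two_lines_ab q (u : 'rV[R]_q) : a *: (b *: u) = 0.
Proof. by case: ab2 => -[_ _ ab] _ _ _ _; rewrite scalerA ab scale0r. Qed.

Lemma two_lines_ba q (u : 'rV[R]_q) : b *: (a *: u) = 0.
Proof. by case: ab2 => -[_ _ ab] _ _ _ _; rewrite scalerA mulrC ab scale0r. Qed.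

Lemma two_lines_disj q (u v : 'rV[R]_q) : a *: u = b *: v -> a *: u = 0.
Proof.
case: ab2 => _ _ _ _ disj /rowP e; apply/rowP => j; have := e j.
by rewrite !mxE; apply: disj.
Qed.

(** Divide by [a] as long as possible. If this never ended, then at a coordinate where [a *: u] is
    nonzero the ideals generated by [k e] and [b] would ascend; once they are stationary, a Nakayama
    argument puts that coordinate of [k e] into [R b], which [a] kills. *)
Lemma two_lines_primitive q (u : 'rV[R]_q) :
  a *: u != 0 -> exists e k, a *: u = a ^+ e.+1 *: k /\ unimodular k.
Proof.
move=> u0; apply: contrapT => none.
have {}none e k : a *: u = a ^+ e.+1 *: k -> mx_nonunit k.
  move=> uk i j; rewrite ord1 => kj; apply: none; exists e, k.
  by split=> //; exists j.
have /choice[k kE] : forall e, exists k, a *: u = a ^+ e.+1 *: k.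
  elim=> [|e [k kE]]; first by exists u.
  have [k1 [k2 k12]] := two_lines_decomp (none e k kE).
  exists k1; rewrite kE k12 scalerDr scalerA -exprSr.
  by rewrite [in X in _ + X]exprSr -scalerA two_lines_ab scaler0 addr0.
have [j uj] : exists j, (a *: u) 0 j != 0.
  apply: contrapT => nj; move/eqP: u0; apply; apply/rowP => j.
  by rewrite [RHS]mxE; apply: contrapT => /eqP uj; apply: nj; exists j.
have cE e : (a *: u) 0 j = a ^+ e.+1 * k e 0 j by rewrite (kE e) mxE.
have chain e : exists s, k e 0 j = a * k e.+1 0 j + b * s.
  have [|s sE] := @two_lines_annX e (k e 0 j - a * k e.+1 0 j).
    by rewrite mulrBr mulrA -exprSr -!cE subrr.
  by exists s; rewrite -sE addrC subrK.
have [||m mP] := ideals_acc fg (P := fun e y => exists s t, y = k e 0 j * s + b * t).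
- move=> e; split; first by exists 0, 0; rewrite !mulr0 addr0.
    move=> _ _ [s [t ->]] [s' [t' ->]]; exists (s + s'), (t + t').
    by rewrite !mulrDr addrACA.
  move=> c _ [s [t ->]]; exists (c * s), (c * t).
  by rewrite mulrDr !(mulrCA c).
- move=> e _ [s [t ->]]; have [w ->] := chain e.
  exists (a * s), (w * s + t).
  by rewrite mulrDl mulrDr -!mulrA [k e.+1 0 j * (a * s)]mulrCA -addrA.
have [|s [t E]] := mP m.+1 (k m.+1 0 j).
  by exists 1, 0; rewrite mulr1 mulr0 addr0.
have [w E'] := chain m.
have [d dE] : invertible (1 - a * s).
  by apply: invertible_1B => //; apply: nonunitMr; case: two_lines_nonunit.
have : (1 - a * s) * k m 0 j = b * w.
  rewrite mulrBl mul1r {1}E' E mulrDr -!mulrA [a * (b * t)]mulrA.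
  case: ab2 => -[_ _ ->] _ _ _ _; rewrite mul0r addr0 [s * _]mulrC.
  by rewrite [_ + b * w]addrC addrK.
move=> /(congr1 ( *%R d)); rewrite [LHS]mulrA [d * (1 - _)]mulrC dE mul1r => kE'.
move/eqP: uj; apply; rewrite (cE m) kE' exprSr -mulrA [a * _]mulrCA [a * _]mulrA.
by case: ab2 => -[_ _ ->] _ _ _ _; rewrite mul0r !mulr0.
Qed.

(** If [k *m A = a *: w], then [b *: k] is killed by [A] and equals some [v *m A']. Were all entries
    of [v] nonunits, the entry of [b *: k] at a unit of [k] would lie in [m^2 = R a^2 + R b^2]; then
    [b] would lie in [R b^2] and vanish. *)
Lemma divides_row_syzygy p q s (A' : 'M[R]_(p, q)) (A : 'M[R]_(q, s)) :
  mx_nonunit A' -> exm A' A -> divides_row a A -> divides_row b A'.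
Proof.
move=> A'0 [_ ex] [k [j kj] [w kA]].
have [|v vE] := ex _ (b *: k); first by rewrite -scalemxAl kA two_lines_ba.
exists v; last by exists k.
apply: contrapT => nv.
have v0 : mx_nonunit v by move=> i l; rewrite ord1 => vl; apply: nv; exists l.
have [v1 [v2 v12]] := two_lines_decomp v0.
have A'c : forall l, exists st, A' l j = a * st.1 + b * st.2.
  move=> l; case: ab2 => _ dec _ _ _; have [c [d e]] := dec _ (A'0 l j).
  by exists (c, d).
have [f fE] := choice A'c.
have ab : a * b = 0 by case: ab2 => -[].
have /rowP/(_ j) := vE; rewrite v12 !mxE.
under eq_bigr => l _.
  rewrite fE !mxE (_ : _ * _ =
    a * (a * (v1 0 l * (f l).1)) + b * (b * (v2 0 l * (f l).2))).
  over.
  transitivity (a * (a * (v1 0 l * (f l).1)) + b * (b * (v2 0 l * (f l).2))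
     + a * b * (v1 0 l * (f l).2 + v2 0 l * (f l).1)); first by ring.
  by rewrite ab mul0r addr0.
rewrite big_split /= -!mulr_sumr.
set S := a * \sum_(i < _) _; set T := \sum_(i < _) _ => E.
have disj : a * S = 0.
  case: ab2 => _ _ _ _ disj; apply: (disj _ (k 0 j - b * T)).
  by rewrite mulrBr E addrK.
have [_ nb] := two_lines_nonunit.
case: kj => c cE.
have : b * (1 - b * (T * c)) = 0.
  apply/eqP; rewrite mulrBr mulr1 subr_eq0; apply/eqP.
  by rewrite -{1}[b]mulr1 -cE mulrA E disj add0r -!mulrA.
move/eqP; rewrite mulrC => /eqP /invertible_cancel b0.
case: ab2 => -[_ /eqP nb0 _] _ _ _ _; apply: nb0; apply: b0.
by apply: invertible_1B => //; apply: nonunitMr.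
Qed.

(** Write [a *: u = a ^+ e.+1 *: k] with [k] unimodular; [k *m A] is killed by a power of [a], hence
    divisible by [b]. *)
Lemma divides_row_kernel p q (u : 'rV[R]_p) (A : 'M[R]_(p, q)) :
  a *: u != 0 -> (a *: u) *m A = 0 -> divides_row b A.
Proof.
move=> /two_lines_primitive[e [k [-> uk]]]; rewrite -scalemxAl => /rowP kA.
exists k => //; have /choice[w wE] : forall j, exists s, (k *m A) 0 j = b * s.
  by move=> j; apply: (@two_lines_annX e); have := kA j; rewrite !mxE.
by exists (\row_j w j); apply/rowP => j; rewrite wE !mxE.
Qed.

(* If [k *m A = a *: al] and [k' *m B = b *: be], then the matrix [k^T *m k']
   has a unit entry, and [A^T] sends it to [al^T *m (a *: k')], whose rows are
   syzygies of [B]. *)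
Lemma tor_obstruction p q p' s t s' (A2 : 'M[R]_(p', p)) (A : 'M[R]_(p, q))
    (B' : 'M[R]_(s', s)) (B : 'M[R]_(s, t)) :
  mx_nonunit A2 -> mx_nonunit B' -> exm B' B ->
  (forall U V, A^T *m U = V *m B' -> exists W V', U = A2^T *m W + V' *m B') ->
  divides_row a A -> ~ divides_row b B.
Proof.
move=> A20 B'0 [_ ex] tor [k [i ki] [al kA]] [k' [j kj] [be kB]].
have [|w wE] := ex _ (a *: k'); first by rewrite -scalemxAl kB two_lines_ab.
have [|W [V' E]] := tor (k^T *m k') (al^T *m w).
  rewrite mulmxA -trmx_mul kA -mulmxA -wE -scalemxAr.
  by rewrite linearZ /= -scalemxAl.
have : nonunit ((k^T *m k') i j).
  rewrite E; apply: mx_nonunitD => //.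
    by apply: mx_nonunitMr => //; apply: mx_nonunit_tr.
  exact: mx_nonunitMl.
by apply; rewrite mxE big_ord1 mxE; apply: invertibleM.
Qed.

End OneLine.

Variables a b : R.
Hypotheses (loc : nonunits_closed R) (fg : ideals_fg R) (ab2 : two_lines a b).

(** A nonzero row of [A'] has the form [a *: u1 + b *: u2]. The images of the two parts under [A]
    lie in different lines and cancel, so both are 0, while one of the parts is not. *)
Lemma divides_row_exists p q s (A' : 'M[R]_(p, q)) (A : 'M[R]_(q, s)) :
  mx_nonunit A' -> A' *m A = 0 -> A' != 0 ->
  divides_row a A \/ divides_row b A.
Proof.
move=> A'0 A'A A'n0.
have [i ri] : exists i, row i A' != 0.
  apply: contrapT => ni; move/eqP: A'n0; apply; apply/row_matrixP => i.
  rewrite row0; apply: contrapT => /eqP ri; apply: ni; by exists i.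
have riA : row i A' *m A = 0 by rewrite -row_mul A'A row0.
have [|u1 [u2 uE]] := @two_lines_decomp _ _ ab2 _ (row i A').
  by move=> ? j; rewrite mxE.
move: riA; rewrite uE mulmxDl => /eqP; rewrite addr_eq0 => /eqP e.
have e1 : (a *: u1) *m A = 0.
  rewrite -scalemxAl; apply: (two_lines_disj ab2 (v := - (u2 *m A))).
  by rewrite scalerN !scalemxAl e.
have e2 : (b *: u2) *m A = 0 by apply/eqP; rewrite -oppr_eq0 -e e1.
have [u10|n1] := eqVneq (a *: u1) 0; last first.
  by right; apply: (divides_row_kernel loc fg ab2 n1).
left; apply: (divides_row_kernel loc fg (two_linesC ab2) _ e2).
by apply: contraNneq ri => u20; rewrite uE u10 u20 addr0.
Qed.

Lemma divides_row_shift n r (A : forall i, 'M[R]_(r i.+1, r i)) :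
  exact_from n A -> (forall i, mx_nonunit (A i)) ->
  divides_row a (A n) \/ divides_row b (A n) ->
  exists i j, [/\ (n <= i)%N, (n <= j)%N, divides_row a (A i)
                & divides_row b (A j)].
Proof.
move=> ex A0 [d|d]; [exists n, n.+1|exists n.+1, n]; split=> //.
  exact: (divides_row_syzygy loc ab2 (A0 n.+1) (ex _ (leqnn n))).
exact: (divides_row_syzygy loc (two_linesC ab2) (A0 n.+1) (ex _ (leqnn n))).
Qed.

(** If both maps were nonzero, some [A i] would have a row divisible by [a] and some [B j] one
    divisible by [b], with [i, j >= n]; [tor_obstruction] forbids this. *)
Lemma two_lines_tor n r s (A : forall i, 'M[R]_(r i.+1, r i))
    (B : forall i, 'M[R]_(s i.+1, s i)) :
  exact_from n A -> (forall i, mx_nonunit (A i)) ->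
  exact_from n B -> (forall i, mx_nonunit (B i)) ->
  tor_from n A B -> A n.+1 = 0 \/ B n.+1 = 0.
Proof.
move=> exA A0 exB B0 tor.
have [|An] := eqVneq (A n.+1) 0; first by left.
have [|Bn] := eqVneq (B n.+1) 0; first by right.
have [//|i [_ [ni _ dA _]]] := divides_row_shift exA A0.
  exact: divides_row_exists (A0 _) (exA _ (leqnn n)).1 An.
have [//|_ [j [_ nj _ dB]]] := divides_row_shift exB B0.
  exact: divides_row_exists (B0 _) (exB _ (leqnn n)).1 Bn.
exfalso; apply: (tor_obstruction loc ab2 (A0 i.+1) (B0 j.+1) (exB j nj) _ dA dB).
by move=> U V; apply: tor => //; apply: leqW.
Qed.

End TwoLines.

(** * Split maximal ideals and finite injective dimension *)

Lemma mulmx11 (R : comNzRingType) n (c : 'M[R]_1) (B : 'rV_n) :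
  c *m B = c 0 0 *: B.
Proof. by rewrite {1}[c]mx11_scalar mul_scalar_mx. Qed.

Section ConsComplex.
Variable R : comNzRingType.

Definition cons_rank (p : nat) (r : nat -> nat) (i : nat) : nat :=
  if i is j.+1 then r j else p.

Definition cons_mx (p : nat) (r : nat -> nat) (A0 : 'M[R]_(r 0%N, p))
    (A : forall i, 'M[R]_(r i.+1, r i)) (i : nat) :
    'M[R]_(cons_rank p r i.+1, cons_rank p r i) :=
  match i return 'M[R]_(cons_rank p r i.+1, cons_rank p r i) with
  | 0 => A0
  | j.+1 => A j
  end.

Lemma exact_from_cons p r (A0 : 'M[R]_(r 0%N, p))
    (A : forall i, 'M[R]_(r i.+1, r i)) :
  exm (A 0%N) A0 -> exact_from 0 A -> exact_from 0 (cons_mx A0 A).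
Proof. by move=> ex0 ex [|i] _ //=; apply: ex. Qed.

Lemma exm_block p q s p' q' s' (A' : 'M[R]_(p, q)) (A : 'M[R]_(q, s))
    (B' : 'M[R]_(p', q')) (B : 'M[R]_(q', s')) :
  exm A' A -> exm B' B -> exm (block_mx A' 0 0 B') (block_mx A 0 0 B).
Proof.
move=> [zA eA] [zB eB]; split=> [|k U].
  by rewrite mulmx_block !mulmx0 !mul0mx zA zB !addr0 block_mx0.
rewrite -[U]hsubmxK mul_row_block !mulmx0 addr0 add0r -row_mx0.
move=> /eq_row_mx[/eA[V ->] /eB[V' ->]].
by exists (row_mx V V'); rewrite mul_row_block !mulmx0 addr0 add0r.
Qed.

End ConsComplex.

Section SplitMaximalIdeal.
Variable R : comNzRingType.
Hypotheses (loc : nonunits_closed R) (fg : ideals_fg R).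

(** Properness of [I] and [J] is implied: if one contained 1, the other would lie in it and be 0. *)
Definition split_maximal (I J : R -> Prop) : Prop :=
  [/\ ideal_pred I /\ ideal_pred J,
      exists2 y, I y & y != 0, exists2 y, J y & y != 0,
      forall y, I y -> J y -> y = 0 &
      forall r, nonunit r -> exists i j, [/\ I i, J j & r = i + j]].

Lemma split_maximalC I J : split_maximal I J -> split_maximal J I.
Proof.
move=> [[sI sJ] nI nJ disj dec]; split=> // [y Jy Iy|r]; first exact: disj.
by move=> /dec[i [j [Ii Jj ->]]]; exists j, i; rewrite addrC.
Qed.

Definition ideal_resolution (I : R -> Prop) (r : nat -> nat)
    (A : forall i, 'M[R]_(r i.+1, r i)) (a : 'cV[R]_(r 0%N)) : Prop :=
  [/\ exact_from 0 A, exm (A 0%N) a &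
      forall y, I y <-> exists u : 'rV_(r 0%N), y = (u *m a) 0 0].

(* [Ext^(j+1)(I, R) = 0], tested on every free resolution of [I]. *)
Definition ideal_ext_vanishes (I : R -> Prop) (j : nat) : Prop :=
  forall r (A : forall i, 'M[R]_(r i.+1, r i)) a, ideal_resolution I A a ->
  forall phi : 'cV_(r j.+1), A j.+1 *m phi = 0 -> exists psi, phi = A j *m psi.

Lemma ideal_resolution_exists (I : R -> Prop) : ideal_pred I ->
  exists r (A : forall i, 'M[R]_(r i.+1, r i)) a, ideal_resolution I A a.
Proof.
move=> /fg[m [a ga]].
have [r [A0 [A [e0 e1 e2 _]]]] := resolution_exists fg (mulmxr a).
exists (cons_rank m r), (cons_mx A0 A), a; split.
- exact: exact_from_cons.
- exact: exm_row.
- exact: ga.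
Qed.

Section Step.
Variables I J : R -> Prop.
Hypothesis IJ : split_maximal I J.

Lemma split_maximal_mul i j : I i -> J j -> i * j = 0.
Proof.
case: IJ => -[[_ _ ZI] [_ _ ZJ]] _ _ disj _ Ii Jj; apply: disj.
  by rewrite mulrC; apply: (ZI j).
exact: (ZJ i).
Qed.

Variables (r : nat -> nat) (A : forall i, 'M[R]_(r i.+1, r i)) (a : 'cV[R]_(r 0%N)).
Hypothesis resA : ideal_resolution I A a.

(* The syzygies of generators [b] of [J] are [I e_0 (+) N'] with
   [N' = {u in syz b | u_0 in J}]: the resolution of [I] is a direct summand of
   a shifted resolution of [J]. *)
Lemma split_maximal_resolution : exists d (b : 'cV[R]_d.+1) z
    (Z : 'M[R]_(z, d.+1)) (t : nat -> nat) (C0 : 'M[R]_(t 0%N, z))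
    (C : forall i, 'M[R]_(t i.+1, t i)),
  let B := @cons_mx R d.+1 (fun i => (r i + cons_rank z t i)%N)
     (col_mx (a *m delta_mx 0 0) Z)
     (fun i => block_mx (A i) 0 0 (cons_mx C0 C i)) in
  [/\ ideal_resolution J B b,
      forall u : 'rV_d.+1, (exists v, u = v *m Z) <-> J (u 0 0) /\ u *m b = 0 &
      forall u : 'rV_d.+1, u *m b = 0 -> mx_nonunit u].
Proof.
case: (IJ) => -[subI subJ] _ [y0 Jy0 y00] disj dec.
have [P0 PD PZ] := subJ.
have [[|d] [b [gb bmin]]] := ideal_minimal_generators fg subJ.
  by have /gb[v y0E] := Jy0; case/eqP: y00; rewrite y0E mxE big_ord0.
have Jb (u : 'rV_d.+1) : J ((u *m b) 0 0).
  by apply/gb; exists u.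
have Jbi i : J (b i 0) by have := Jb (delta_mx 0 i); rewrite -rowE mxE.
have [|z [Z' gZ]] := rV_submodule_fg fg
    (P := fun u : 'rV_d.+1 => J (u 0 0) /\ u *m b = 0).
  split; first by rewrite mxE mul0mx.
    move=> u v [Ju ub] [Jv vb]; rewrite mxE mulmxDl ub vb addr0.
    by split=> //; apply: PD.
  move=> c u [Ju ub]; rewrite mxE -scalemxAl ub scaler0; split=> //.
  exact: PZ.
pose Z : 'M[R]_(z, d.+1) := \matrix_i Z' i.
have ZP (u : 'rV_d.+1) : (exists v, u = v *m Z) <-> J (u 0 0) /\ u *m b = 0.
  by rewrite gZ; split=> -[v ->]; exists v; rewrite lincomb_mulmx.
have [t [C0 [C [eC0 eC1 eC2 _]]]] := resolution_exists fg (mulmxr Z).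
exists d, b, z, Z, t, C0, C => B; split=> //.
have [exA exA0 IP] := resA.
have exC0 : exm C0 Z by apply: exm_row.
have exC : exact_from 0 (cons_mx C0 C) by apply: exact_from_cons.
have Ia (u : 'rV_(r 0%N)) : I ((u *m a) 0 0) by apply/IP; exists u.
have ae (u : 'rV_(r 0%N)) :
    u *m (a *m delta_mx 0 0) = (u *m a) 0 0 *: delta_mx 0 (0 : 'I_d.+1).
  by rewrite mulmxA mulmx11.
have aeb : (a *m delta_mx 0 0) *m b = 0.
  apply/row_matrixP => i; rewrite row0 rowE mulmxA ae -scalemxAl.
  have := Ia (delta_mx 0 i); move: (_ 0 0) => c Ic.
  apply/rowP => j; rewrite [j]ord1 -rowE !mxE.
  exact: (split_maximal_mul Ic (Jbi 0)).
split; last first.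
- exact: gb.
- apply: exm_row => u; split.
    (* By minimality of [b] the entry [u 0 0] is a nonunit, equal to [i + j]. Since [I J = 0], the
       row [i e_0] is a syzygy; removing it leaves a syzygy with first entry in [J]. *)
    move=> ub; have [i [j [Ii Jj uij]]] := dec _ (bmin _ ub 0 0).
    have [w wE] := (IP i).1 Ii.
    have [|v vE] := (ZP (u - i *: delta_mx 0 0)).2.
      rewrite !mxE eqxx mulr1 uij [i + j]addrC addrK; split=> //.
      by rewrite mulmxBl ub wE -ae -mulmxA aeb mulmx0 subr0.
    by exists (row_mx w v); rewrite mul_row_col ae -wE -vE addrC subrK.
  move=> [v ->]; rewrite -[v]hsubmxK -mulmxA mul_col_mx aeb.
  have -> : Z *m b = 0.
    apply/row_matrixP => i; rewrite row_mul row0.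
    by have [|_ ->] := (ZP (row i Z)).1 => //; exists (delta_mx 0 i); rewrite -rowE.
  by rewrite col_mx0 mulmx0.
- move=> [|i] _; last by apply: exm_block; [apply: exA|apply: exC].
  split=> [|k U].
    rewrite /B /= mul_block_col !mul0mx addr0 add0r mulmxA exA0.1 mul0mx.
    by rewrite exC0.1 col_mx0.
  rewrite /B /= -[U]hsubmxK; set U1 := lsubmx U; set U2 := rsubmx U.
  rewrite mul_row_col => /eqP; rewrite addr_eq0 => /eqP E.
  (* The sum is direct: the first coordinates of the two summands lie in [I] and in [J], so they can
     only cancel by being 0. *)
  have U1a : U1 *m a = 0.
    apply/matrixP => i j; rewrite [j]ord1 [RHS]mxE.
    have /rowP/(_ 0) := congr1 (row i) E.
    rewrite row_mul ae mxE [delta_mx _ _ _ _]mxE eqxx mulr1 => E0.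
    have <- : (row i U1 *m a) 0 0 = (U1 *m a) i 0 by rewrite -row_mul mxE.
    apply: disj (Ia _) _; rewrite E0.
    have [|+ _] := (ZP (- row i U2 *m Z)).1; first by exists (- row i U2).
    by rewrite mulNmx -row_mul !mxE.
  have [_ /(_ _ _ U1a)[V1 ->]] := exA0.
  have [|V2 ->] := exC0.2 _ U2.
    by apply/eqP; rewrite -oppr_eq0 -E mulmxA U1a mul0mx.
  by exists (row_mx V1 V2); rewrite mul_row_block !mulmx0 addr0 add0r.
Qed.

End Step.

(** A cocycle on the resolution of [I], extended by 0 to the other summand, is a cocycle one degree
    higher on the resolution of [J]. *)
Lemma ideal_ext_shift I J j : split_maximal I J ->
  ideal_ext_vanishes J j.+1 -> ideal_ext_vanishes I j.
Proof.
move=> IJ extJ r A a resA phi Aphi.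
have [d [b [z [Z [t [C0 [C [resB _ _]]]]]]]] := split_maximal_resolution IJ resA.
have [|psi] := extJ _ _ _ resB (col_mx phi 0).
  by rewrite /= mul_block_col Aphi !mul0mx !mulmx0 !addr0 col_mx0.
rewrite /= -[psi]vsubmxK mul_block_col mul0mx addr0 => /eq_col_mx[-> _].
by exists (usubmx psi).
Qed.

(* The inclusion [I -> R], extended by [0] on [N'], is a homomorphism on the
   first syzygies of [J]; by [Ext^1(J, R) = 0] it is given by a column [psi],
   whose first entry is a unit.  Since [psi] kills the Koszul syzygies lying
   in [N'], [J] has a single generator. *)
Lemma split_maximal_principal I J : split_maximal I J ->
  ideal_ext_vanishes J 0 ->
  exists2 b, (forall y, J y <-> exists s, y = b * s) &
             forall r, b * r = 0 -> I r.
Proof.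
move=> IJ extJ; case: (IJ) => -[subI subJ] [x0 Ix0 x00] [y0 Jy0 y00] disj dec.
have [r [A [a resA]]] := ideal_resolution_exists subI.
have [_ exA0 IP] := resA.
have [d [b [z [Z [t [C0 [C [resB ZP bmin]]]]]]]] := split_maximal_resolution IJ resA.
have [_ _ JP] := resB.
have [|psi] := extJ _ _ _ resB (col_mx a 0).
  by rewrite /= mul_block_col exA0.1 !mul0mx !mulmx0 !addr0 col_mx0.
rewrite /= mul_col_mx => /eq_col_mx[aE /esym Zpsi].
have {}aE i : a i 0 = a i 0 * psi 0 0.
  by rewrite {1}aE -mulmxA -rowE mxE big_ord1 mxE.
(* Each generator satisfies [a i 0 = a i 0 * psi 0 0]; if [1 - psi 0 0] were invertible, [I] would
   be 0. *)
have upsi : invertible (psi 0 0).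
  apply: contrapT => /(invertible_1B loc) inv1.
  case/eqP: x00; have [u ->] := (IP x0).1 Ix0.
  rewrite mxE big1 // => i _; rewrite (invertible_cancel inv1 (s := a i 0)) ?mulr0 //.
  by rewrite mulrC mulrBr mulr1 -aE subrr.
have Npsi (u : 'rV_d.+1) : J (u 0 0) -> u *m b = 0 -> u *m psi = 0.
  move=> Ju ub; have [|v ->] := (ZP u).2; first by [].
  by rewrite -mulmxA Zpsi mulmx0.
have Jb i : J (b i 0).
  by apply/JP; exists (delta_mx 0 i); rewrite -rowE mxE.
(* With two generators, the Koszul syzygy [b_1 e_0 - b_0 e_1] has first entry in [J], so [psi] kills
   it. Read the other way, [psi_0 e_1 - psi_1 e_0] is a syzygy of [b] with a unit entry, against
   minimality. *)
case: d => [|d] in b Z resB ZP bmin JP psi aE Zpsi upsi Npsi Jb *; last first.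
  exfalso; pose e0 : 'rV[R]_d.+2 := delta_mx 0 0.
  pose e1 : 'rV[R]_d.+2 := delta_mx 0 1.
  have mul_e i (c : 'cV[R]_d.+2) : delta_mx 0 i *m c = (c i 0)%:M.
    by rewrite -rowE; apply/matrixP => p q; rewrite !ord1 !mxE eqxx.
  have Koz : (b 1 0 *: e0 - b 0 0 *: e1) *m psi = 0.
    apply: Npsi; first by rewrite !mxE /= mulr1 mulr0 subr0.
    rewrite mulmxBl -!scalemxAl !mul_e -!mul_scalar_mx -!scalar_mxM.
    by rewrite mulrC subrr.
  suff /(_ 0 1) : mx_nonunit (psi 0 0 *: e1 - psi 1 0 *: e0).
    by apply; rewrite !mxE /= mulr1 mulr0 subr0.
  apply: bmin; move: Koz.
  rewrite !mulmxBl -!scalemxAl !mul_e -!mul_scalar_mx -!scalar_mxM.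
  by rewrite mulrC [psi 1 0 * _]mulrC.
have JE y : J y <-> exists s, y = b 0 0 * s.
  rewrite JP; split=> [[u ->]|[s ->]].
    by exists (u 0 0); rewrite mxE big_ord1 mulrC.
  by exists s%:M; rewrite mul_scalar_mx mxE mulrC.
exists (b 0 0) => // s bs.
have ns : nonunit s.
  move=> us; case/eqP: y00; have [w ->] := (JE y0).1 Jy0.
  by rewrite (invertible_cancel us (s := b 0 0)) ?mul0r // mulrC.
have [i [j [Ii Jj sE]]] := dec _ ns.
(* From [i b = 0] follows [j b = 0], so the 1 x 1 row [j] is a syzygy with entry in [J]. It is
   killed by the unit [psi], whence [j = 0] and [s] lies in [I]. *)
have bi : i * b 0 0 = 0 by apply: split_maximal_mul IJ _ _ Ii (Jb 0).
have jb : j * b 0 0 = 0 by move: bs; rewrite sE mulrC mulrDl bi add0r.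
have jb0 : j%:M *m b = 0.
  by rewrite mul_scalar_mx; apply/matrixP => p q; rewrite !ord1 !mxE.
have J0 : J ((j%:M : 'rV_1) 0 0) by rewrite mxE eqxx mulr1n.
have := Npsi _ J0 jb0.
rewrite mul_scalar_mx => /matrixP/(_ 0 0); rewrite !mxE mulrC => jpsi.
by rewrite sE (invertible_cancel upsi jpsi) addr0.
Qed.

Lemma split_maximal_two_lines I J l : split_maximal I J ->
  dual_exact_from R l -> exists a b : R, two_lines a b.
Proof.
move=> IJ dual; have JI := split_maximalC IJ.
have extl K : ideal_ext_vanishes K l.
  by move=> r A a [exA _ _]; apply: (dual r A exA l (leqnn l)).
(* Each step down in degree exchanges the two ideals, so both are carried through the induction. *)
have [extI extJ] : ideal_ext_vanishes I 0 /\ ideal_ext_vanishes J 0.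
  have : ideal_ext_vanishes I l /\ ideal_ext_vanishes J l by [].
  elim: l {dual extl} => // l IHl [eI eJ]; apply: IHl; split.
    exact: ideal_ext_shift IJ eJ.
  exact: ideal_ext_shift JI eI.
have [a Ia annI] := split_maximal_principal JI extI.
have [b Jb annJ] := split_maximal_principal IJ extJ.
case: (IJ) => _ [x0 Ix0 x00] [y0 Jy0 y00] disj dec.
have IaS s : I (a * s) by apply/Ia; exists s.
have JbS s : J (b * s) by apply/Jb; exists s.
exists a, b; split.
- split.
  + by apply: contraNneq x00 => a0; have [s ->] := (Ia _).1 Ix0; rewrite a0 mul0r.
  + by apply: contraNneq y00 => b0; have [s ->] := (Jb _).1 Jy0; rewrite b0 mul0r.
  + apply: (split_maximal_mul IJ); [by rewrite -[a]mulr1|by rewrite -[b]mulr1].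
- by move=> r /dec[i [j [/Ia[s ->] /Jb[t ->] ->]]]; exists s, t.
- by move=> r /annI/Jb.
- by move=> r /annJ/Ia.
- by move=> s t e; apply: disj => //; rewrite e.
Qed.

End SplitMaximalIdeal.

(** * Quasi-fiber product rings *)

Section LocalNoetherian.
Variable R : comNzRingType.

Lemma idealr_of_pred (P : R -> Prop) : ideal_pred P -> ~ P 1 ->
  exists I : idealr R, forall r, r \in I <-> P r.
Proof.
move=> [P0 PD PZ] P1; pose p : {pred R} := fun r => `[< P r >].
have pP r : r \in p <-> P r by split=> [/asboolP|?] //; apply/asboolP.
have cl : idealr_closed p.
  split; first by apply/pP.
    by apply/negP => /pP.
  by move=> a u v /pP Pu /pP Pv; apply/pP; apply: PD => //; apply: PZ.
pose I : idealr R := HB.pack (p : R -> bool) (isIdealr.Build R p cl).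
by exists I.
Qed.

Lemma ideal_pred_idealr (I : idealr R) : ideal_pred (fun r => r \in I).
Proof.
split; [exact: rpred0|by move=> *; apply: rpredD|].
by move=> a u; apply: idealMr.
Qed.

Lemma ideal_pred_generated (s : seq R) : ideal_pred (generated_ideal s).
Proof.
split; first by exists (fun=> 0); rewrite big1 // => i _; rewrite mul0r.
  move=> _ _ [a ->] [b ->]; exists (fun i => a i + b i).
  by rewrite -big_split; apply: eq_bigr => i _; rewrite mulrDl.
move=> c _ [a ->]; exists (fun i => c * a i).
by rewrite mulr_sumr; apply: eq_bigr => i _; rewrite mulrA.
Qed.

Lemma mem_generated_ideal (s : seq R) y : y \in s -> generated_ideal s y.
Proof.
move=> /(nthP 0)[i si <-]; exists (fun j : 'I_(size s) => (j == Ordinal si)%:R).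
rewrite (bigD1 (Ordinal si)) //= eqxx mul1r big1 ?addr0 // => j /negPf ->.
by rewrite mul0r.
Qed.

Lemma generated_ideal_min (s : seq R) (P : R -> Prop) : ideal_pred P ->
  (forall y, y \in s -> P y) -> forall r, generated_ideal s r -> P r.
Proof.
move=> [P0 PD PZ] sP _ [a ->]; apply: big_ind => // i _.
by apply: PZ; apply: sP; apply: mem_nth.
Qed.

Lemma generated_ideal_rcons (s : seq R) y r :
  generated_ideal (rcons s y) r <-> exists c, generated_ideal s (r - y * c).
Proof.
have [g0 gD gZ] := ideal_pred_generated (rcons s y).
have [h0 hD hZ] := ideal_pred_generated s.
split=> [|[c gc]].
  apply: (@generated_ideal_min (rcons s y)
            (fun r => exists c, generated_ideal s (r - y * c))) => [|z].
    split; first by exists 0; rewrite mulr0 subr0.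
      move=> u v [c uc] [d vd]; exists (c + d).
      by rewrite mulrDr opprD addrACA; apply: hD.
    move=> a u [c uc]; exists (a * c).
    by rewrite mulrCA -mulrBr; apply: hZ.
  rewrite mem_rcons inE => /orP[/eqP->|zs].
    by exists 1; rewrite mulr1 subrr.
  by exists 0; rewrite mulr0 subr0; apply: mem_generated_ideal.
rewrite -[r](subrK (y * c)); apply: gD.
  apply: (@generated_ideal_min s (generated_ideal (rcons s y))) gc => [|z zs].
    exact: ideal_pred_generated.
  by apply: mem_generated_ideal; rewrite mem_rcons inE zs orbT.
by rewrite mulrC; apply: gZ; apply: mem_generated_ideal; rewrite mem_rcons mem_head.
Qed.

Lemma noetherian_ideals_fg : noetherian R -> ideals_fg R.
Proof.
move=> noeth P idP; have [P1|nP1] := EM (P 1).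
  exists 1%N, 1%:M => y; split=> [_|_].
    by exists y%:M; rewrite mulmx1 mxE eqxx mulr1n.
  by case: idP => _ _ PZ; rewrite -[y]mulr1; apply: PZ.
have [I IP] := idealr_of_pred idP nP1.
have [s sP] := noeth I.
exists (size s), (\col_i s`_i) => y; rewrite -IP sP.
split=> [[a ->]|[u ->]].
  by exists (\row_i a i); rewrite mxE; apply: eq_bigr => i _; rewrite !mxE.
by exists (fun i => u 0 i); rewrite mxE; apply: eq_bigr => i _; rewrite !mxE.
Qed.

(** A nonunit [r] outside [m] would lie in no maximal ideal, so every proper ideal containing [r]
    would be strictly contained in another one. Starting from [R r], this contradicts the ascending
    chain condition. *)
Lemma local_nonunits_closed :
  noetherian R -> local_ring R -> nonunits_closed R.
Proof.
move=> /noetherian_ideals_fg fg [m mmax muniq].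
suff nm r : nonunit r -> r \in m.
  move=> r s /nm rm /nm sm [t e].
  have := idealr1 m; rewrite -e mulrC => /negP; apply.
  by apply: idealMr; apply: rpredD.
move=> nr; apply: contrapT => rm.
pose T := {P : R -> Prop | [/\ ideal_pred P, ~ P 1 & P r]}.
have /choice[next nextP] : forall P : T, exists Q : T,
    (forall y, sval P y -> sval Q y) /\ exists2 y, sval Q y & ~ sval P y.
  move=> [P /= [idP P1 Pr]]; have [I IP] := idealr_of_pred idP P1.
  have : ~ maximal_ideal I by move=> /muniq Im; apply: rm; rewrite -Im; apply/IP.
  move=> /existsNP[J] /not_implyP[IJ JI].
  have QP : [/\ ideal_pred (fun r => r \in J), ~ 1 \in J & r \in J].
    split; first exact: ideal_pred_idealr.
      by rewrite idealr1.
    by apply: IJ; apply/IP.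
  exists (exist _ (fun y => is_true (y \in J)) QP) => /=; split=> [y /IP/IJ //|].
  apply: contrapT => nJ; apply: JI => y yJ; apply/IP.
  by apply: contrapT => Py; apply: nJ; exists y.
have P0 : [/\ ideal_pred (fun y => exists s, y = r * s),
              ~ exists s, 1 = r * s & exists s, r = r * s].
  split=> [|[s e]|]; last by exists 1; rewrite mulr1.
    split; first by exists 0; rewrite mulr0.
      by move=> _ _ [s ->] [t ->]; exists (s + t); rewrite mulrDr.
    by move=> a _ [s ->]; exists (a * s); rewrite mulrCA.
  by apply: nr; exists s.
pose Q k := iter k next (exist _ (fun y => exists s, y = r * s) P0 : T).
have [||k kP] := ideals_acc fg (P := fun k => sval (Q k)).
- by move=> k; case: (svalP (Q k)).
- by move=> k y; case: (nextP (Q k)) => + _; apply.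
have [_ [y yQ]] := nextP (Q k); apply; exact: (kP k.+1).
Qed.

Lemma ideal_quot_eq0 (I : idealr R) (r : R) :
  \pi_{ideal_quot I} r = 0 :> {ideal_quot I} <-> r \in I.
Proof.
rewrite -[0 in X in X <-> _](rmorph0 (\pi_{ideal_quot I})).
rewrite -[r in X in _ <-> X]subr0 Quotient.idealrBE.
by split=> /eqP.
Qed.

Lemma ideal_quotient_exists (I : idealr R) :
  exists (R' : comNzRingType) (pi : {rmorphism R -> R'}),
    (forall y, exists r, pi r = y) /\ forall r, pi r = 0 <-> r \in I.
Proof.
exists {ideal_quot I}, (\pi_{ideal_quot I} : {rmorphism R -> {ideal_quot I}}).
split=> [y|r]; first by exists (repr y); apply: reprK.
exact: ideal_quot_eq0.
Qed.

End LocalNoetherian.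

Lemma nonunits_closed_quotient (R R' : comNzRingType) (pi : {rmorphism R -> R'}) :
  (forall y, exists r, pi r = y) -> nonunits_closed R -> nonunits_closed R'.
Proof.
move=> surj loc r' s'; have [r <-] := surj r'; have [s <-] := surj s'.
have lift t : nonunit (pi t) -> nonunit t.
  by move=> nt [u e]; apply: nt; exists (pi u); rewrite -rmorphM e rmorph1.
move=> /lift nr /lift ns [t'].
have [t <-] := surj t'; rewrite -rmorphD -rmorphM => e.
have nz : nonunit (1 - (r + s) * t).
  by apply: lift; rewrite rmorphB e rmorph1 subrr; apply: nonunit0.
have n1 : nonunit ((r + s) * t + (1 - (r + s) * t)).
  by apply: (loc) => //; apply: nonunitMr; apply: loc.
by move: n1; rewrite addrC subrK; apply; apply: invertible1.
Qed.

Section RegularSequence.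
Variables (R : comNzRingType) (x : seq R).
Hypothesis x_reg : regular_sequence x.

(** Divide by one element at a time: the image of the next entry of [x] is regular in the previous
    quotient. Each division raises by one the degree from which exactness and the vanishing of Tor
    are known. *)
Lemma regular_sequence_quotient k : (k <= size x)%N ->
  exists (R' : comNzRingType) (pi : {rmorphism R -> R'}),
  [/\ (forall y, exists r, pi r = y) /\
      (forall r, pi r = 0 <-> generated_ideal (take k x) r),
      forall l, dual_exact_from R l -> dual_exact_from R' l,
      forall r (A : forall i, 'M[R]_(r i.+1, r i)), exact_from 0 A ->
        exact_from k (fun i => map_mx pi (A i)) &
      forall r (A : forall i, 'M[R]_(r i.+1, r i))
             s (B : forall i, 'M[R]_(s i.+1, s i)),
        exact_from 0 A -> exact_from 0 B -> tor_from 0 A B ->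
        tor_from k (fun i => map_mx pi (A i)) (fun i => map_mx pi (B i))].
Proof.
elim: k => [_|k IHk kx].
  have idE r (A : forall i, 'M[R]_(r i.+1, r i)) :
      (fun i => map_mx (idfun : {rmorphism R -> R}) (A i)) = A.
    by apply: functional_extensionality_dep => i; rewrite map_mx_id.
  exists R, idfun; split=> [|//|r A|r A s B]; rewrite ?idE //.
  split=> [y|r]; first by exists y.
  rewrite take0; split=> [/= ->|[a ->]]; last by rewrite /= big_ord0.
  by case: (ideal_pred_generated (Nil R)).
have [R1 [pi1 [[surj1 ker1] dual1 ex1 tor1]]] := IHk (ltnW kx).
pose y := pi1 x`_k.
have takeS : take k.+1 x = rcons (take k x) x`_k by apply: take_nth.
have idY : ideal_pred (fun r => exists s, r = y * s).
  split; first by exists 0; rewrite mulr0.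
    by move=> _ _ [s ->] [t ->]; exists (s + t); rewrite mulrDr.
  by move=> a _ [s ->]; exists (a * s); rewrite mulrCA.
have ker12 r : (exists s, pi1 r = y * s) <-> generated_ideal (take k.+1 x) r.
  rewrite takeS generated_ideal_rcons; split=> [[s' e]|[c /ker1/eqP]].
    have [s sE] := surj1 s'; exists s; apply/ker1.
    by rewrite rmorphB rmorphM sE e subrr.
  by rewrite rmorphB rmorphM subr_eq0 => /eqP ->; exists (pi1 c).
have [|I IP] := idealr_of_pred idY.
  rewrite -(rmorph1 pi1) => /ker12 g1; case: x_reg => _; apply.
  apply: (@generated_ideal_min _ (take k.+1 x) (generated_ideal x)) g1.
    exact: ideal_pred_generated.
  by move=> z /mem_take; apply: mem_generated_ideal.
have [R2 [pi2 [surj2 ker2]]] := ideal_quotient_exists I.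
have ker2' r : pi2 r = 0 <-> exists s, r = y * s by rewrite ker2 IP.
have regy r : y * r = 0 -> r = 0.
  have [t <-] := surj1 r; rewrite -rmorphM => /ker1 h; apply/ker1.
  by case: x_reg => h1 _; apply: h1 h.
have compE r (A : forall i, 'M[R]_(r i.+1, r i)) :
    (fun i => map_mx (pi2 \o pi1 : {rmorphism R -> R2}) (A i)) =
    (fun i => map_mx pi2 (map_mx pi1 (A i))).
  by apply: functional_extensionality_dep => i; rewrite map_mx_comp.
exists R2, (pi2 \o pi1); split.
- split=> [z|r]; first by have [w <-] := surj2 z; have [r <-] := surj1 w; exists r.
  by rewrite -ker12 -ker2'.
- by move=> l /dual1; apply: (dual_exact_from_quotient surj2 ker2' regy).
- move=> r A exA; rewrite compE.
  exact: (exact_from_quotient surj2 ker2' regy (ex1 _ _ exA)).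
- move=> r A s B exA exB tor; rewrite !compE.
  apply: (tor_from_quotient surj2 ker2' regy (ex1 _ _ exA) (ex1 _ _ exB)).
  exact: tor1.
Qed.

End RegularSequence.

(** * From fiber products to split maximal ideals *)

Section FiberProductSplit.

Lemma reduction_invertible (S : comNzRingType) (k : fieldType)
    (piS : {rmorphism S -> k}) s :
  nonunits_closed S -> reduction piS -> piS s != 0 -> invertible s.
Proof.
move=> loc red s0; apply: contrapT => ns.
have [u uE] := red (piS s)^-1.
have nz : nonunit (1 - s * u).
  move=> [t /(congr1 piS)/eqP].
  by rewrite !(rmorphM, rmorphB, rmorph1) /= uE divff // subrr mul0r eq_sym oner_eq0.
have n1 : nonunit (s * u + (1 - s * u)).
  by apply: loc => //; apply: nonunitMr.
by move: n1; rewrite addrC subrK; apply; apply: invertible1.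
Qed.

(** The ideals are [ker piS x 0] and [0 x ker piT]. A pair with nonzero residue is invertible,
    because the inverses of its components again have equal residues. *)
Lemma fiber_product_split (Q : comNzRingType) : fiber_product_ring Q ->
  exists I J : Q -> Prop, split_maximal I J.
Proof.
move=> [S [T [k [piS [piT [[nS lS] [nT lT] [rS rT] [iS iT] [f [h fK hK]]]]]]]].
pose p q : S * T := val (f q).
have pD q r : p (q + r) = p q + p r by rewrite /p !rmorphD.
have pM q r : p (q * r) = p q * p r by rewrite /p !rmorphM.
have p0 : p 0 = 0 by rewrite /p !rmorph0.
have p1 : p 1 = 1 by rewrite /p !rmorph1.
have pinj : injective p by move=> q r /val_inj /(can_inj fK).
have psurj s t : piS s = piT t -> exists q, p q = (s, t).
  move=> e; have st : (s, t) \in fiber_pred piS piT by rewrite inE /= e.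
  by exists (h (FiberProduct st)); rewrite /p hK.
have pE q : piS (p q).1 = piT (p q).2 by apply/eqP; apply: (valP (f q)).
have noninj (A B : comNzRingType) (g : {rmorphism A -> B}) :
    ~ injective g -> exists2 a, g a = 0 & a != 0.
  move=> ni; apply: contrapT => na; apply: ni => a b e.
  apply/eqP; rewrite -subr_eq0; apply: contrapT => /negP ab; apply: na.
  by exists (a - b) => //; rewrite rmorphB e subrr.
exists (fun q => (p q).2 = 0), (fun q => (p q).1 = 0); split.
- split; split.
  + by rewrite p0.
  + by move=> q r q0 r0; rewrite pD /= q0 r0 addr0.
  + by move=> a q q0; rewrite pM /= q0 mulr0.
  + by rewrite p0.
  + by move=> q r q0 r0; rewrite pD /= q0 r0 addr0.
  + by move=> a q q0; rewrite pM /= q0 mulr0.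
- have [s s0 sn] := noninj _ _ _ iS.
  have [|q qE] := psurj s 0; first by rewrite s0 rmorph0.
  exists q; rewrite ?qE //; apply: contraNneq sn => q0.
  by move: qE; rewrite q0 p0 => -[<-].
- have [t t0 tn] := noninj _ _ _ iT.
  have [|q qE] := psurj 0 t; first by rewrite t0 rmorph0.
  exists q; rewrite ?qE //; apply: contraNneq tn => q0.
  by move: qE; rewrite q0 p0 => -[<-].
- move=> q q2 q1; apply: pinj; rewrite p0.
  by case: (p q) q1 q2 => /= s t -> ->.
move=> q nq; have q1 : piS (p q).1 = 0.
  apply: contrapT => /eqP c0; apply: nq.
  have [s sE] := reduction_invertible (local_nonunits_closed nS lS) rS c0.
  move: (c0); rewrite pE => c0'.
  have [t tE] := reduction_invertible (local_nonunits_closed nT lT) rT c0'.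
  have [|r rE] := psurj s t.
    by apply: (mulfI c0); rewrite -rmorphM sE {1}pE -rmorphM tE !rmorph1.
  exists r; apply: pinj; rewrite pM rE p1.
  by case: (p q) sE tE => a b /= sE tE; congr pair.
have [|i iE] := psurj (p q).1 0; first by rewrite q1 rmorph0.
have [|j jE] := psurj 0 (p q).2; first by rewrite -pE q1 rmorph0.
exists i, j; rewrite iE jE; split=> //; apply: pinj; rewrite pD iE jE.
by case: (p q) => a b; congr pair => /=; rewrite ?addr0 ?add0r.
Qed.

(** [Q] and [R'] are quotients of [R] by the same ideal. This links the quotient in the definition
    of a quasi-fiber product ring to the one obtained by successive divisions. *)
Lemma split_maximal_transport (R Q R' : comNzRingType)
    (pi1 : {rmorphism R -> Q}) (pi2 : {rmorphism R -> R'}) I J :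
  (forall y, exists r, pi1 r = y) -> (forall y, exists r, pi2 r = y) ->
  (forall r, pi1 r = 0 <-> pi2 r = 0) ->
  split_maximal (R := Q) I J -> exists I' J', split_maximal (R := R') I' J'.
Proof.
move=> surj1 surj2 ker [[idI idJ] [y Iy y0] [z Jz z0] disj dec].
have ker_eq r s : pi2 r = pi2 s -> pi1 r = pi1 s.
  move=> e; apply/eqP; rewrite -subr_eq0 -rmorphB; apply/eqP/ker.
  by rewrite rmorphB e subrr.
pose tr (K : Q -> Prop) y' := exists2 r, pi2 r = y' & K (pi1 r).
have trI K : ideal_pred K -> ideal_pred (tr K).
  move=> [K0 KD KZ]; split; first by exists 0; rewrite rmorph0.
    move=> _ _ [r <- Kr] [s <- Ks]; exists (r + s); rewrite rmorphD //.
    exact: KD.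
  move=> a' _ [r <- Kr]; have [a <-] := surj2 a'; exists (a * r); rewrite rmorphM //.
  exact: KZ.
have trn (K : Q -> Prop) w : K w -> w != 0 -> exists2 y', tr K y' & y' != 0.
  move=> Kw w0; have [r rE] := surj1 w; exists (pi2 r).
    by exists r; rewrite ?rE.
  by apply: contraNneq w0 => /ker; rewrite rE => ->.
exists (tr I), (tr J); split.
- by split; apply: trI.
- exact: trn y0.
- exact: trn z0.
- move=> _ [r <- Ir] [s /ker_eq e Js]; apply/ker; apply: disj => //.
  by rewrite -e.
move=> r' nr'; have [r rE] := surj2 r'; have [|i [j [Ii Jj e]]] := dec (pi1 r).
  move=> [t' e]; have [t tE] := surj1 t'; apply: nr'; exists (pi2 t).
  apply/eqP; rewrite -rE -rmorphM -subr_eq0 -(rmorph1 pi2) -rmorphB; apply/eqP/ker.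
  by rewrite rmorphB rmorphM tE e rmorph1 subrr.
have [a aE] := surj1 i; have [b bE] := surj1 j.
exists (pi2 a), (pi2 b); split; [by exists a; rewrite ?aE|by exists b; rewrite ?bE|].
apply/eqP; rewrite -rE -rmorphD -subr_eq0 -rmorphB; apply/eqP/ker.
by rewrite rmorphB rmorphD aE bE e subrr.
Qed.

End FiberProductSplit.

Lemma quasi_fiber_product_quotient (R : comNzRingType) (x : seq R) l :
  noetherian R -> local_ring R -> dual_exact_from R l ->
  quasi_fiber_product_ring x ->
  exists (R' : comNzRingType) (pi : {rmorphism R -> R'}) (a b : R'),
  [/\ nonunits_closed R' /\ ideals_fg R', two_lines a b,
      forall r, nonunit r -> nonunit (pi r),
      forall r (A : forall i, 'M[R]_(r i.+1, r i)), exact_from 0 A ->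
        exact_from (size x) (fun i => map_mx pi (A i)) &
      forall r (A : forall i, 'M[R]_(r i.+1, r i))
             s (B : forall i, 'M[R]_(s i.+1, s i)),
        exact_from 0 A -> exact_from 0 B -> tor_from 0 A B ->
        tor_from (size x) (fun i => map_mx pi (A i)) (fun i => map_mx pi (B i))].
Proof.
move=> nR lR dualR [x_reg [I IP fib]].
have [R' [pi [[surj ker] dual ex tor]]] :=
  regular_sequence_quotient x_reg (leqnn (size x)).
have loc := local_nonunits_closed nR lR.
have loc' := nonunits_closed_quotient surj loc.
have fg' := ideals_fg_quotient surj (noetherian_ideals_fg nR).
have [I0 [J0 split0]] := fiber_product_split fib.
have [||I' [J' split']] := split_maximal_transport
    (pi1 := \pi_{ideal_quot I} : {rmorphism R -> {ideal_quot I}}) _ surj _ split0.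
- by move=> y; exists (repr y); apply: reprK.
- by move=> r; rewrite ker take_size -IP; apply: ideal_quot_eq0.
have [a [b ab]] := split_maximal_two_lines loc' fg' split' (dual _ dualR).
exists R', pi, a, b; split=> //.
move=> r nr [t' e]; have [t tE] := surj t'.
have n1 : nonunit (r * t + (1 - r * t)).
  apply: loc; first exact: nonunitMr.
  move=> [u /(congr1 pi)/eqP]; rewrite !(rmorphM, rmorphB, rmorph1) /= tE e.
  by rewrite subrr mul0r eq_sym oner_eq0.
by move: n1; rewrite addrC subrK; apply; apply: invertible1.
Qed.

(** * Modules, projectivity and injectivity *)

Section QuotientModule.
Variables (R : comNzRingType) (V : lmodType R) (P : V -> Prop).
Hypothesis subP : submodule P.

Definition quotient_pred : {pred V} := fun u => `[< P u >].

Fact quotient_pred_zmod : zmod_closed quotient_pred.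
Proof.
case: subP => P0 PD PZ; split=> [|u v /asboolP Pu /asboolP Pv].
  exact/asboolP.
by apply/asboolP; apply: PD => //; rewrite -scaleN1r; apply: PZ.
Qed.

HB.instance Definition _ := GRing.isZmodClosed.Build V quotient_pred
  quotient_pred_zmod.

Definition quotient_module : Type := Quotient.quot quotient_pred.
HB.instance Definition _ := GRing.Zmodule.on quotient_module.

Definition quotient_proj (u : V) : quotient_module :=
  \pi_(Quotient.quot quotient_pred) u.

Lemma quotient_proj_eq u v : quotient_proj u = quotient_proj v <-> P (u - v).
Proof.
rewrite /quotient_proj; split=> [/eqP|Puv].
  by rewrite -Quotient.idealrBE => /asboolP.
by apply/eqP; rewrite -Quotient.idealrBE; apply/asboolP.
Qed.

Lemma quotient_proj_surj (y : quotient_module) : exists u, quotient_proj u = y.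
Proof. by exists (repr y); apply: reprK. Qed.

Definition quotient_scale (a : R) (y : quotient_module) : quotient_module :=
  quotient_proj (a *: repr y).

Lemma quotient_scale_proj a u :
  quotient_scale a (quotient_proj u) = quotient_proj (a *: u).
Proof.
apply/quotient_proj_eq; rewrite -scalerBr; case: subP => _ _; apply.
by apply/quotient_proj_eq; apply: reprK.
Qed.

Fact quotient_scaleA a b u :
  quotient_scale a (quotient_scale b u) = quotient_scale (a * b) u.
Proof.
by have [v <-] := quotient_proj_surj u; rewrite !quotient_scale_proj scalerA.
Qed.

Fact quotient_scale1 : left_id 1 quotient_scale.
Proof.
move=> u; have [v <-] := quotient_proj_surj u.
by rewrite quotient_scale_proj scale1r.
Qed.

Fact quotient_projD u v : quotient_proj (u + v) = quotient_proj u + quotient_proj v.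
Proof. exact: (raddfD (\pi_(Quotient.quot quotient_pred))). Qed.

Fact quotient_scaleDr : right_distributive quotient_scale +%R.
Proof.
move=> a u v; have [u' <-] := quotient_proj_surj u.
have [v' <-] := quotient_proj_surj v.
by rewrite -quotient_projD !quotient_scale_proj scalerDr quotient_projD.
Qed.

Fact quotient_scaleDl u : {morph quotient_scale^~ u : a b / a + b}.
Proof.
move=> a b; have [u' <-] := quotient_proj_surj u.
by rewrite !quotient_scale_proj scalerDl quotient_projD.
Qed.

HB.instance Definition _ := GRing.Zmodule_isLmodule.Build R quotient_module
  quotient_scaleA quotient_scale1 quotient_scaleDr quotient_scaleDl.

Fact quotient_proj_linear : linear quotient_proj.
Proof. by move=> a u v; rewrite quotient_projD -quotient_scale_proj. Qed.

HB.instance Definition _ := GRing.isLinear.Build R V quotient_module *:%R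
  quotient_proj quotient_proj_linear.

Lemma quotient_proj_eq0 u : quotient_proj u = 0 <-> P u.
Proof. by rewrite -(linear0 quotient_proj) quotient_proj_eq subr0. Qed.

End QuotientModule.

Section Modules.
Variable R : comNzRingType.
Implicit Types (A B C V W E P : lmodType R).

Lemma quotient_module_exists V (P : V -> Prop) : submodule P ->
  exists (W : lmodType R) (q : {linear V -> W}),
    (forall y, exists u, q u = y) /\ forall u, q u = 0 <-> P u.
Proof.
move=> subP; exists (quotient_module subP : lmodType R), (quotient_proj subP).
by split; [apply: quotient_proj_surj|apply: quotient_proj_eq0].
Qed.

Lemma submodule_ker V W (f : {linear V -> W}) : submodule (fun u => f u = 0).
Proof.
split; first exact: linear0.
  by move=> u v fu fv; rewrite linearD fu fv addr0.
by move=> a u fu; rewrite linearZ /= fu scaler0.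
Qed.

Lemma linear_of V W (f : V -> W) : linear f ->
  exists g : {linear V -> W}, forall u, g u = f u.
Proof.
move=> lf; pose g : {linear V -> W} :=
  HB.pack f (GRing.isLinear.Build R V W *:%R f lf).
by exists g.
Qed.

Lemma linear_eq V W (f : {linear V -> W}) u v : f u = f v <-> f (u - v) = 0.
Proof.
rewrite linearB; split=> [->|/eqP]; first by rewrite subrr.
by rewrite subr_eq0 => /eqP.
Qed.

Lemma linear_factor V W C (q : {linear V -> W}) (f : {linear V -> C}) :
  (forall y, exists u, q u = y) -> (forall u, q u = 0 -> f u = 0) ->
  exists g : {linear W -> C}, forall u, g (q u) = f u.
Proof.
move=> surj ker; have [h hE] := choice surj.
have hq u : f (h (q u)) = f u.
  by apply/linear_eq; apply: ker; apply/linear_eq.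
have [|g gE] := @linear_of _ _ (fun y => f (h y)).
  move=> a y z; rewrite -linearZ /= -linearD; apply/linear_eq; apply: ker.
  by apply/linear_eq; rewrite linearD linearZ /= !hE.
by exists g => u; rewrite gE.
Qed.

Lemma linear_corestrict V A B (p : {linear A -> B}) (f : {linear V -> B}) :
  injective p -> (forall u, exists a, p a = f u) ->
  exists g : {linear V -> A}, forall u, p (g u) = f u.
Proof.
move=> inj /choice[h hE].
have [|g gE] := @linear_of _ _ h; last by exists g => u; rewrite gE.
by move=> a u v; apply: inj; rewrite !linearP /= !hE linearP.
Qed.

(** The image of [p] is realised as [A] modulo the kernel of [p]; by exactness [f] corestricts to
    it, and there projectivity applies. *)
Lemma projective_lift P A B C (p : {linear A -> B}) (q : {linear B -> C})
    (f : {linear P -> B}) :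
  projective P -> exact p q -> (forall u, q (f u) = 0) ->
  exists g : {linear P -> A}, forall u, p (g u) = f u.
Proof.
move=> projP ex qf.
have [W [pr [prs prk]]] := quotient_module_exists (submodule_ker p).
have [|p' p'E] := @linear_factor _ _ _ pr p prs; first by move=> u /prk.
have p'inj : injective p'.
  move=> y z; have [u <-] := prs y; have [v <-] := prs z.
  rewrite !p'E => /linear_eq puv; apply/linear_eq; exact/prk.
have [|f' f'E] := @linear_corestrict _ _ _ p' f p'inj.
  by move=> u; have [a <-] := (ex _).1 (qf u); exists (pr a); rewrite p'E.
have [g gE] := projP _ _ pr f' prs.
by exists g => u; rewrite -p'E gE f'E.
Qed.

Lemma injective_extend V W E (h : {linear V -> W}) (f : {linear V -> E}) :
  injective_module E -> (forall u, h u = 0 -> f u = 0) ->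
  exists g : {linear W -> E}, forall u, g (h u) = f u.
Proof.
move=> injE ker.
have [Q [pr [prs prk]]] := quotient_module_exists (submodule_ker h).
have [|h' h'E] := @linear_factor _ _ _ pr h prs; first by move=> u /prk.
have [|f' f'E] := @linear_factor _ _ _ pr f prs; first by move=> u /prk/ker.
have h'inj : injective h'.
  move=> y z; have [u <-] := prs y; have [v <-] := prs z.
  rewrite !h'E => /linear_eq puv; apply/linear_eq; exact/prk.
have [g gE] := injE _ _ h' f' h'inj.
by exists g => u; rewrite -h'E gE f'E.
Qed.

Lemma linear_rV_lincomb n V (f : {linear 'rV[R]_n -> V}) u :
  f u = lincomb (fun i => f (delta_mx 0 i)) u.
Proof.
rewrite /lincomb {1}(row_sum_delta u) linear_sum; apply: eq_bigr => i _.
by rewrite linearZ.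
Qed.

Lemma projective_rV n : projective 'rV[R]_n.
Proof.
move=> A B p f surj.
have [s sE] := choice (fun i : 'I_n => surj (f (delta_mx 0 i))).
exists (lincomb s) => u; rewrite [RHS]linear_rV_lincomb /lincomb linear_sum.
by apply: eq_bigr => i _; rewrite linearZ /= sE.
Qed.

Definition mulmxr_lin m n (A : 'M[R]_(m, n)) : {linear 'rV[R]_m -> 'rV[R]_n} :=
  mulmxr A.

Lemma linear_rV_mulmx m n (f : {linear 'rV[R]_m -> 'rV[R]_n}) :
  exists A : 'M[R]_(m, n), forall u, f u = u *m A.
Proof. by exists (lin1_mx f) => u; rewrite mul_rV_lin1. Qed.

End Modules.

(** * Finite injective dimension and exactness of duals *)

Section InjectiveDimension.
Variable R : comNzRingType.

(** Dimension shifting along [E]: [key] is the vanishing of [Ext^(j+1)] with values in the cycles of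
    [E i], for [j + i >= l], by descending induction on [i]. At [i = l] all of [E l] consists of
    cycles; at [i = 0] the cycles are [R]. *)
Lemma inj_resolution_dual_exact (l : nat) (E : inj_resolution (R^o : lmodType R)) :
  (forall i, (l < i)%N -> forall u : E i, u = 0) -> dual_exact_from R l.
Proof.
move=> El r A exA.
have key i : (i <= l)%N -> forall j, (l <= j + i)%N ->
    forall f : {linear 'rV[R]_(r j.+1) -> E i},
    (forall u, f (u *m A j.+1) = 0) -> (forall u, inj_diff E i (f u) = 0) ->
    exists g : {linear 'rV_(r j) -> E i},
      (forall u, f u = g (u *m A j)) /\ forall u, inj_diff E i (g u) = 0.
  move=> /subnKC; move: (l - i)%N => m; elim: m i => [|m IHm] i lE j lj f fA df.
    have [|g gE] := injective_extend (h := mulmxr_lin (A j)) (f := f)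
      (@inj_termP _ _ E i).
      move=> u uA; have [v ->] := (exA j isT).2 _ _ uA.
      exact: fA.
    by exists g; split=> u; [rewrite -gE|apply: El; rewrite -lE addn0].
  have [|g0 g0E] := injective_extend (h := mulmxr_lin (A j)) (f := f)
    (@inj_termP _ _ E i).
    move=> u uA; have [v ->] := (exA j isT).2 _ _ uA.
    exact: fA.
  case: j => [|j] in lj f fA df g0 g0E *.
    by move: lj; rewrite -lE add0n -[X in (_ <= X)%N]addn0 leq_add2l.
  (* The extension [g0] need not take values in cycles. Its boundary is a cocycle at [i.+1], hence
     comes from some [g1]; lifting [g1] through [inj_diff E i] yields the correction [g2]. *)
  have [||||g1 [g1E dg1]] := IHm i.+1 _ j _ (inj_diff E i \o g0).
  - by rewrite addSnnS.
  - by rewrite addnS -addSn.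
  - by move=> u /=; rewrite g0E df.
  - by move=> u; apply: (@inj_exactS _ _ E i _).2; exists (g0 u).
  have [g2 g2E] := projective_lift (@projective_rV R _) (@inj_exactS _ _ E i) dg1.
  exists (g0 \- (g2 \o mulmxr_lin (A j))); split=> u /=.
    by rewrite g0E /= -mulmxA (exA j isT).1 mulmx0 linear0 subr0.
  by rewrite linearB /= g2E -g1E subrr.
move=> j lj phi Aphi.
have [|phil philE] := @linear_of R 'rV[R]_(r j.+1) R^o (fun u => (u *m phi) 0 0).
  by move=> a u v; rewrite mulmxDl -scalemxAl mxE [X in X + _]mxE.
have lj0 : (l <= j + 0)%N by rewrite addn0.
have [||g [gE dg]] := key 0%N isT j lj0 (inj_aug E \o phil).
- by move=> u /=; rewrite philE -mulmxA Aphi mulmx0 mxE linear0.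
- by move=> u; apply: (@inj_exact0 _ _ E _).2; exists (phil u).
have [|psi psiE] := linear_corestrict (f := g) (@inj_aug_inj _ _ E).
  by move=> u; apply: (@inj_exact0 _ _ E _).1.
exists (\col_i (psi (delta_mx 0 i) : R)).
apply/colP => i.
have := gE (delta_mx 0 i); rewrite -psiE => e.
have := @inj_aug_inj _ _ E _ _ e; rewrite philE -!rowE mxE => ->.
by rewrite linear_rV_lincomb mxE; apply: eq_bigr => k _; rewrite !mxE.
Qed.

End InjectiveDimension.

(** * Independence of the projective resolution *)

Section Comparison.
Variables (R : comNzRingType) (N : lmodType R).
Implicit Types P : proj_resolution N.

Definition proj_cycle P (i : nat) : P i -> Prop :=
  match i return P i -> Prop with
  | 0 => fun u => proj_aug P u = 0
  | j.+1 => fun u => proj_diff P j u = 0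
  end.

Lemma proj_cycleP P i u : proj_cycle u <-> exists w, proj_diff P i w = u.
Proof.
by case: i u => [|i] u; [apply: (@proj_exact0 _ _ P)|apply: (@proj_exactS _ _ P)].
Qed.

Lemma proj_diff_diff P i u : proj_diff P i (proj_diff P i.+1 u) = 0.
Proof. by apply: (@proj_exactS _ _ P i _).2; exists u. Qed.

Lemma proj_cycle_lift P i (L : lmodType R) (f : {linear L -> P i}) :
  projective L -> (forall u, proj_cycle (f u)) ->
  exists g : {linear L -> P i.+1}, forall u, proj_diff P i (g u) = f u.
Proof.
move=> projL; case: i f => [|i] f cf.
  exact: projective_lift projL (@proj_exact0 _ _ P) cf.
exact: projective_lift projL (@proj_exactS _ _ P i) cf.
Qed.

(** Dependent choice asks for a next map at every stage, also where the induction hypothesis [Q]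
    fails; the zero map is the default there. *)
Lemma linear_default (V W : lmodType R) (Q : Prop) (H : {linear V -> W} -> Prop) :
  (Q -> exists f, H f) -> exists f, Q -> H f.
Proof.
have [q /(_ q)[f Hf]|nq _] := EM Q; first by exists f.
have [|z _] := @linear_of R V W (fun=> 0); last by exists z.
by move=> a u v; rewrite scaler0 addr0.
Qed.

Lemma chain_map_exists P P' : exists f : forall i, {linear P' i -> P i},
  (forall u, proj_aug P (f 0%N u) = proj_aug P' u) /\
  forall i u, proj_diff P i (f i.+1 u) = f i (proj_diff P' i u).
Proof.
pose T := {i : nat & {linear P' i -> P i}}.
have /choice_dep[next nextP] : forall x : T,
    exists g : {linear P' (projT1 x).+1 -> P (projT1 x).+1},
    (forall u, proj_cycle u -> proj_cycle (projT2 x u)) ->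
    forall u, proj_diff P _ (g u) = projT2 x (proj_diff P' _ u).
  move=> [i f] /=; apply: linear_default => cf.
  have [|g gE] := @proj_cycle_lift P i _ (f \o proj_diff P' i)
    (@proj_termP _ _ P' i.+1).
    by move=> u; apply: cf; apply/proj_cycleP; exists u.
  by exists g.
have [f0 f0E] := @proj_termP _ _ P' 0 _ _ (proj_aug P) (proj_aug P')
  (proj_aug_surj P).
pose f := fix f i : {linear P' i -> P i} :=
  match i with 0 => f0 | j.+1 => next (existT _ j (f j)) end.
have fc i u : proj_cycle u -> proj_cycle (f i u).
  elim: i u => [|i IHi] u /=; first by rewrite f0E.
  move=> du; rewrite (nextP (existT _ i (f i)) IHi) /= du.
  by rewrite linear0.
exists f; split=> [//|i u].
exact: (nextP (existT _ i (f i)) (@fc i)).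
Qed.

Lemma homotopy_exists P (h : forall i, {linear P i -> P i}) :
  (forall u, proj_aug P (h 0%N u) = 0) ->
  (forall i u, proj_diff P i (h i.+1 u) = h i (proj_diff P i u)) ->
  exists s : forall i, {linear P i -> P i.+1},
    forall i u, h i.+1 u = proj_diff P i.+1 (s i.+1 u) + s i (proj_diff P i u).
Proof.
move=> h0 hS; pose T := {i : nat & {linear P i -> P i.+1}}.
pose good i (s : {linear P i -> P i.+1}) :=
  forall u, proj_cycle u -> proj_diff P i (s u) = h i u.
have /choice_dep[next nextP] : forall x : T,
    exists g : {linear P (projT1 x).+1 -> P (projT1 x).+2},
    good _ (projT2 x) ->
    forall u, proj_diff P _ (g u) = h _ u - projT2 x (proj_diff P _ u).
  move=> [i s] /=; apply: linear_default => gs.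
  apply: (@proj_cycle_lift P i.+1 _ (h i.+1 \- (s \o proj_diff P i))
    (@proj_termP _ _ P i.+1)).
  move=> u /=; rewrite linearB hS /= gs ?subrr //.
  by apply/proj_cycleP; exists u.
have [s0 s0E] := @proj_cycle_lift P 0 _ (h 0%N) (@proj_termP _ _ P 0) h0.
pose s := fix s i : {linear P i -> P i.+1} :=
  match i with 0 => s0 | j.+1 => next (existT _ j (s j)) end.
have gs i : good i (s i).
  elim: i => [|i IHi] u /=; first by rewrite s0E.
  by move=> du; rewrite (nextP (existT _ i (s i)) IHi) /= du linear0 subr0.
exists s => i u.
by rewrite (nextP (existT _ i (s i)) (@gs i)) /= subrK.
Qed.

Lemma resolution_comparison P P' : exists (f : forall i, {linear P' i -> P i})
    (g : forall i, {linear P i -> P' i}) (s : forall i, {linear P' i -> P' i.+1}),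
  [/\ forall i u, proj_diff P i (f i.+1 u) = f i (proj_diff P' i u),
      forall i u, proj_diff P' i (g i.+1 u) = g i (proj_diff P i u) &
      forall i u, u = g i.+1 (f i.+1 u) +
        (proj_diff P' i.+1 (s i.+1 u) + s i (proj_diff P' i u))].
Proof.
have [f [f0 fS]] := chain_map_exists P P'.
have [g [g0 gS]] := chain_map_exists P' P.
have [||s sE] := @homotopy_exists P' (fun i => idfun \- (g i \o f i)).
- by move=> u /=; rewrite linearB /= g0 f0 subrr.
- by move=> i u /=; rewrite linearB /= gS fS.
exists f, g, s; split=> // i u; rewrite -sE /=.
by rewrite addrC subrK.
Qed.

Lemma hom_acyclic_indep P P' M i :
  hom_acyclic P M i.+1 -> hom_acyclic P' M i.+1.
Proof.
have [f [g [s [fS gS sE]]]] := resolution_comparison P P'.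
move=> ac h hd; have [|k kE] := ac (h \o g i.+1).
  by move=> u /=; rewrite -gS hd.
exists ((k \o f i) \+ (h \o s i)) => u /=.
by rewrite -fS -kE /= -linearD {1}[u](sE i) !linearD /= hd add0r.
Qed.

Lemma tensor_eq (M Z W : lmodType R) (h k : {linear tensor M Z -> W}) :
  (forall m z, h (pure_tensor m z) = k (pure_tensor m z)) -> forall u, h u = k u.
Proof.
move=> hk u; rewrite [u]tensor_sum_pure !linear_sum.
by apply: eq_bigr => p _; apply: hk.
Qed.

Lemma tensor_map_comp (A B C Z : lmodType R) (f : {linear A -> B})
    (g : {linear B -> C}) (h : {linear A -> C}) :
  (forall a, g (f a) = h a) ->
  forall u : tensor A Z, tensor_map g (tensor_map f u) = tensor_map h u.
Proof.
move=> e; apply: (@tensor_eq _ _ _ (tensor_map g \o tensor_map f) (tensor_map h)).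
by move=> m z /=; rewrite !tensor_map_pureE e.
Qed.

Lemma tensor_map0 (A B Z : lmodType R) (f : {linear A -> B}) :
  (forall a, f a = 0) -> forall u : tensor A Z, tensor_map f u = 0.
Proof.
move=> e u; rewrite [u]tensor_sum_pure linear_sum big1 // => p _.
by rewrite /= tensor_map_pureE e linear0l.
Qed.

Lemma tensor_mapD (A B Z : lmodType R) (f g h : {linear A -> B}) :
  (forall a, h a = f a + g a) ->
  forall u : tensor A Z, tensor_map h u = tensor_map f u + tensor_map g u.
Proof.
move=> e; apply: (@tensor_eq _ _ _ (tensor_map h) (tensor_map f \+ tensor_map g)).
by move=> m z /=; rewrite !tensor_map_pureE e linearDl.
Qed.

Lemma tensor_acyclic_indep P P' Z i :
  tensor_acyclic P Z i.+1 -> tensor_acyclic P' Z i.+1.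
Proof.
have [f [g [s [fS gS sE]]]] := resolution_comparison P P'.
pose t (A B : lmodType R) (h : {linear A -> B}) := @tensor_map R A B Z h.
move=> ac b; split=> [db|[a <-]]; last first.
  rewrite (tensor_map_comp (h := proj_diff P' i \o proj_diff P' i.+1)) //.
  by apply: tensor_map0 => u /=; apply: proj_diff_diff.
have [|w wE] := (ac (t _ _ (f i.+1) b)).1.
  rewrite /t (tensor_map_comp (h := f i \o proj_diff P' i)) => [|u /=];
    last exact: fS.
  by rewrite -(tensor_map_comp (f := proj_diff P' i) (g := f i)) // db linear0.
exists (t _ _ (g i.+2) w + t _ _ (s i.+1) b).
have sum : t _ _ idfun b = t _ _ (g i.+1 \o f i.+1) b +
    t _ _ (proj_diff P' i.+1 \o s i.+1) b + t _ _ (s i \o proj_diff P' i) b.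
  rewrite -addrA -(tensor_mapD
    (h := (proj_diff P' i.+1 \o s i.+1) \+ (s i \o proj_diff P' i))) //.
  rewrite -(tensor_mapD (h := idfun)) // => u; exact: sE.
have idE : t _ _ idfun b = b.
  apply: (@tensor_eq _ _ _ (tensor_map idfun) idfun) => m z.
  by rewrite /= tensor_map_pureE.
rewrite -[RHS]idE sum linearD /= /t.
rewrite -[tensor_map (s i \o _) b](tensor_map_comp
  (f := proj_diff P' i) (g := s i)) // db linear0 addr0.
congr (_ + _); last exact: tensor_map_comp.
rewrite -(tensor_map_comp (f := f i.+1) (g := g i.+1) (h := g i.+1 \o f i.+1)) //.
rewrite /t in wE *; rewrite -wE.
rewrite (tensor_map_comp (h := g i.+1 \o proj_diff P i.+1)) => [|u /=].
  by symmetry; apply: tensor_map_comp.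
exact: gS.
Qed.

End Comparison.

(** * Ext and Tor in terms of matrices *)

Section MatrixResolution.
Variables (R : comNzRingType) (M : lmodType R) (r : nat -> nat).
Variables (A : forall i, 'M[R]_(r i.+1, r i)) (s : 'I_(r 0%N) -> M).

Definition mx_resolution : Prop :=
  [/\ exact_from 0 A, forall u, lincomb s u = 0 <-> exists v, u = v *m A 0%N &
      forall w, exists u, w = lincomb s u].

Hypothesis resA : mx_resolution.

Fact mx_resolution_surj w : exists u, lincomb s u = w.
Proof. by case: resA => _ _ surj; have [u ->] := surj w; exists u. Qed.

Fact mx_resolution_exact0 : exact (mulmxr_lin (A 0%N)) (lincomb s).
Proof. by case: resA => _ ex _ u; rewrite ex; split=> -[v e]; exists v. Qed.

Fact mx_resolution_exactS i : exact (mulmxr_lin (A i.+1)) (mulmxr_lin (A i)).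
Proof.
case: resA => exA _ _ u; split=> [/(exA i isT).2[v ->]|[v <-]]; first by exists v.
by rewrite /= -mulmxA (exA i isT).1 mulmx0.
Qed.

Definition proj_of_mx : proj_resolution M :=
  ProjResolution (proj_term := fun i => 'rV[R]_(r i) : lmodType R)
    (fun i => @projective_rV R (r i)) mx_resolution_surj mx_resolution_exact0
    mx_resolution_exactS.

Lemma finite_proj_dim_mx l : (forall i, (l < i)%N -> r i = 0%N) -> finite_proj_dim M.
Proof.
move=> r0; exists proj_of_mx, l => i li u.
by apply/rowP => -[j jr]; exfalso; rewrite (r0 i li) in jr.
Qed.

Lemma linear_rV_lift (m : nat) (h : {linear 'rV[R]_m -> M}) :
  exists W : 'M_(m, r 0%N), forall u, h u = lincomb s (u *m W).
Proof.
have [g gE] := @projective_rV R m _ _ (lincomb s) h mx_resolution_surj.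
by have [W WE] := linear_rV_mulmx g; exists W => u; rewrite -WE gE.
Qed.

End MatrixResolution.

Section ExtTor.
Variables (R : comNzRingType) (M N : lmodType R) (r s : nat -> nat).
Variables (A : forall i, 'M[R]_(r i.+1, r i)) (a : 'I_(r 0%N) -> M).
Variables (B : forall i, 'M[R]_(s i.+1, s i)) (b : 'I_(s 0%N) -> N).
Hypotheses (resA : mx_resolution A a) (resB : mx_resolution B b).

(** A map from a free module to [N] is given by a matrix [U] into the cover of [N], determined up to
    rows in the image of [B 0]. *)
Lemma Ext_vanishes_mx i : Ext_vanishes i.+1 M N ->
  forall (U : 'M_(r i.+1, s 0%N)) V, A i.+1 *m U = V *m B 0%N ->
    exists W V', U = A i *m W + V' *m B 0%N.
Proof.
move=> [P /(@hom_acyclic_indep _ _ _ (proj_of_mx resA)) ac] U V UV.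
have [_ exB _] := resB.
have [|h hE] := ac (lincomb b \o mulmxr_lin U).
  move=> u; rewrite /= -mulmxA UV.
  by apply/exB; exists (u *m V); rewrite mulmxA.
have [W WE] := linear_rV_lift resB h.
have [|V' V'E] := @mulmx_rowwise _ _ _ _ (U - A i *m W) (B 0%N).
  move=> j; apply/exB; rewrite rowE mulmxBr linearB /=.
  by have := hE (delta_mx 0 j); rewrite /= WE mulmxA => ->; rewrite subrr.
by exists W, V'; rewrite -V'E addrC subrK.
Qed.

Variables (Z : lmodType R) (c c1 : nat) (q : {linear 'rV[R]_c -> Z}).
Variable C0 : 'M[R]_(c1, c).
Hypotheses (q_surj : forall z, exists u, q u = z)
  (q_ker : forall u, q u = 0 <-> exists v, u = v *m C0).

(** Reads the [p]-th coordinate of an element of [R^m (x) Z = Z^m]; it detects when the tensor of a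
    matrix is 0. *)
Definition coord_scale m (p : 'I_m) (v : 'rV[R]_m) (z : Z) : Z := v 0 p *: z.

Fact coord_scale_bilinear m (p : 'I_m) :
  bilinear_for *:%R *:%R (coord_scale p).
Proof.
split=> [z k v v'|v k z z']; rewrite /coord_scale.
  by rewrite !mxE scalerDl -scalerA.
by rewrite scalerDr; congr (_ + _); rewrite /= !scalerA mulrC.
Qed.

HB.instance Definition _ m (p : 'I_m) := bilinear_isBilinear.Build R 'rV[R]_m Z Z
  *:%R *:%R (coord_scale p) (coord_scale_bilinear p).

(* [Y] represents an element of [R^m (x) Z], [Z] being the cokernel of [C0]. *)
Definition tensor_of_mx m (Y : 'M[R]_(m, c)) : tensor 'rV[R]_m Z :=
  \sum_p pure_tensor (delta_mx 0 p) (q (row p Y)).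

Fact tensor_of_mx_linear m : linear (@tensor_of_mx m).
Proof.
move=> k Y Y'; rewrite /tensor_of_mx scaler_sumr -big_split.
by apply: eq_bigr => p _; rewrite !linearP /= linearPr.
Qed.

HB.instance Definition _ m := GRing.isLinear.Build R 'M[R]_(m, c)
  (tensor 'rV[R]_m Z) *:%R (@tensor_of_mx m) (@tensor_of_mx_linear m).

Lemma pure_tensor_of_mx m (v : 'rV[R]_m) u :
  pure_tensor v (q u) = tensor_of_mx (v^T *m u).
Proof.
rewrite /tensor_of_mx {1}(row_sum_delta v) linear_sumlz.
apply: eq_bigr => p _; rewrite linearZl_LR -linearZr_LR -linearZ /=.
by congr (pure_tensor _ (q _)); apply/rowP => j; rewrite !mxE big_ord1 mxE.
Qed.

Lemma tensor_of_mx_surj m (w : tensor 'rV[R]_m Z) : exists Y, tensor_of_mx Y = w.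
Proof.
rewrite [w]tensor_sum_pure.
apply: (big_ind (fun w => exists Y : 'M_(m, c), tensor_of_mx Y = w))
  => [|w1 w2 [Y1 <-] [Y2 <-]|[v z] _].
- by exists 0; rewrite linear0.
- by exists (Y1 + Y2); rewrite linearD.
- by have [u <-] := q_surj z; exists (v^T *m u); rewrite pure_tensor_of_mx.
Qed.

Lemma tensor_of_mx_eq0 m (Y : 'M[R]_(m, c)) :
  tensor_of_mx Y = 0 <-> exists X, Y = X *m C0.
Proof.
split=> [Y0|[X ->]]; last first.
  rewrite /tensor_of_mx big1 // => p _.
  have -> : q (row p (X *m C0)) = 0 by apply/q_ker; exists (row p X); rewrite row_mul.
  exact: linear0r.
apply: mulmx_rowwise => p; apply/q_ker.
have := congr1 (bilin_val (coord_scale p)) Y0.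
rewrite linear0 linear_sum (bigD1 p) //= bilin_val_pure /=.
rewrite /coord_scale mxE !eqxx scale1r.
rewrite big1 ?addr0 // => p' /negPf pp'.
by rewrite bilin_val_pure /= /coord_scale mxE eq_sym pp' andbF scale0r.
Qed.

Lemma tensor_map_of_mx m n (D : 'M[R]_(m, n)) (Y : 'M[R]_(m, c)) :
  tensor_map (mulmxr_lin D) (tensor_of_mx Y) = tensor_of_mx (D^T *m Y).
Proof.
have -> : D^T *m Y = \sum_p (row p D)^T *m row p Y.
  apply/matrixP => i j; rewrite mxE summxE; apply: eq_bigr => p _.
  by rewrite !mxE big_ord1 !mxE.
rewrite !linear_sum; apply: eq_bigr => p _.
by rewrite /= tensor_map_pureE pure_tensor_of_mx [row p D]rowE.
Qed.

Definition mx_tor_vanishes (j : nat) : Prop :=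
  forall (Y : 'M_(s j.+1, c)) X, (B j)^T *m Y = X *m C0 ->
    exists Y' X', Y = (B j.+1)^T *m Y' + X' *m C0.

Lemma Tor_vanishes_mx j : Tor_vanishes j.+1 N Z <-> mx_tor_vanishes j.
Proof.
have -> : Tor_vanishes j.+1 N Z <-> tensor_acyclic (proj_of_mx resB) Z j.+1.
  by split=> [[P]|ac]; [apply: tensor_acyclic_indep|exists (proj_of_mx resB)].
split=> [ac Y X YX|tor w].
  have [|w] := (ac (tensor_of_mx Y)).1.
    by rewrite /= tensor_map_of_mx YX; apply/tensor_of_mx_eq0; exists X.
  have [Y' <-] := tensor_of_mx_surj w; rewrite /= tensor_map_of_mx => e.
  have [|X' X'E] := (tensor_of_mx_eq0 (Y - (B j.+1)^T *m Y')).1.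
    by rewrite linearB /= e subrr.
  by exists Y', X'; rewrite -X'E addrC subrK.
have [Y <-] := tensor_of_mx_surj w; split=> [|[w' <-]].
  rewrite /= tensor_map_of_mx => /tensor_of_mx_eq0[X /tor[Y' [X' ->]]].
  exists (tensor_of_mx Y'); rewrite tensor_map_of_mx linearD /=.
  by rewrite [X in _ + X](tensor_of_mx_eq0 _).2 ?addr0 //; exists X'.
have [Y' <-] := tensor_of_mx_surj w'; rewrite /= !tensor_map_of_mx mulmxA.
rewrite -trmx_mul; case: resB => exB _ _.
by rewrite (exB j isT).1 trmx0 mul0mx linear0.
Qed.

End ExtTor.

(** * The transposed syzygies *)

Section FinGenerated.
Variables (R : comNzRingType) (V : lmodType R).

Lemma fin_generatedP :
  fin_generated V <-> exists m (s : 'I_m -> V), forall w, exists v, w = lincomb s v.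
Proof.
split=> [[s sP]|[m [s sP]]].
  exists (size s), (fun i => s`_i) => w; have [a ->] := sP w.
  by exists (\row_i a i); apply: eq_bigr => i _; rewrite mxE.
exists [seq s i | i <- enum 'I_m] => w; have [v ->] := sP w.
have e : size [seq s i | i <- enum 'I_m] = m by rewrite size_map size_enum_ord.
have nthE (i : 'I_m) : [seq s i | i <- enum 'I_m]`_i = s i.
  by rewrite (nth_map i) ?size_enum_ord // nth_ord_enum.
exists (fun i => v 0 (cast_ord e i)).
rewrite (reindex (cast_ord (esym e))) /=; last first.
  by exists (cast_ord e) => i _; rewrite ?cast_ordK ?cast_ordKV.
by apply: eq_bigr => i _; rewrite nthE cast_ordKV.
Qed.

End FinGenerated.

Section MinimalResolution.
Variable R : comNzRingType.
Hypotheses (loc : nonunits_closed R) (fg : ideals_fg R).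

Lemma minimal_resolution_exists (M : lmodType R) : fin_generated M ->
  exists r (A : forall i, 'M[R]_(r i.+1, r i)) a,
    mx_resolution (M := M) A a /\ forall i, mx_nonunit (A i).
Proof.
move=> /fin_generatedP[m0 [s0 s0P]].
have [|m [s [gs smin]]] := @minimal_generators R M (fun=> True).
  by exists m0, s0 => w; split=> // _; apply: s0P.
have [r [A0 [A [e0 e1 e2 min]]]] := resolution_exists fg (lincomb s).
exists (cons_rank m r), (cons_mx A0 A), s; split.
  split; [exact: exact_from_cons|exact: e0|].
  by move=> w; apply/gs.
case=> [|i] //= p q; have := smin (row p A0).
rewrite (e0 _).2; last by exists (delta_mx 0 p); rewrite -rowE.
by move=> /(_ erefl 0 q); rewrite mxE.
Qed.

(** If [A = 0], the identity matrix factors through [A'], whose entries are nonunits. *)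
Lemma exm_zero_rank p q s (A' : 'M[R]_(p, q)) (A : 'M[R]_(q, s)) :
  exm A' A -> mx_nonunit A' -> A = 0 -> q = 0%N.
Proof.
move=> [_ ex] A'0 A0; have [|V VE] := ex _ 1%:M; first by rewrite A0 mulmx0.
case: q => // q in A' A ex A'0 A0 V VE *.
have /(_ 0 0) : mx_nonunit (V *m A') by apply: mx_nonunitMl.
rewrite -VE mxE eqxx mulr1n.
by case; apply: invertible1.
Qed.

Lemma minimal_resolution_finite (M : lmodType R) r
    (A : forall i, 'M[R]_(r i.+1, r i)) a l :
  mx_resolution (M := M) A a -> (forall i, mx_nonunit (A i)) ->
  r l.+1 = 0%N -> finite_proj_dim M.
Proof.
move=> resA A0 rl; apply: (finite_proj_dim_mx resA (l := l)) => i.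
elim: i => // i IHi; rewrite ltnS leq_eqVlt => /orP[/eqP<- //|/IHi ri].
case: resA => exA _ _; apply: (exm_zero_rank (exA i isT) (A0 i.+1)).
by apply/matrixP => p [j jr]; exfalso; rewrite ri in jr.
Qed.

End MinimalResolution.

Section RigidTor.
Variables (R : comNzRingType) (M N : lmodType R) (r s : nat -> nat).
Variables (A : forall i, 'M[R]_(r i.+1, r i)) (a : 'I_(r 0%N) -> M).
Variables (B : forall i, 'M[R]_(s i.+1, s i)) (b : 'I_(s 0%N) -> N).
Hypotheses (loc : nonunits_closed R) (fg : ideals_fg R).
Hypotheses (resA : mx_resolution A a) (resB : mx_resolution B b).
Hypotheses (A0 : forall i, mx_nonunit (A i)) (B0 : forall i, mx_nonunit (B i)).
Hypotheses (N_nz : nonzero_module N) (N_rigid : Tor_rigid N).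

(* Duality between [Ext^(i+1)(M, N)] and [Tor_1(N, D)], where [D] is the
   transpose of the [(i+1)]-st syzygy of [M]. *)
Lemma ext_vanishes_tor i : Ext_vanishes i.+1 M N ->
  forall j, mx_tor_vanishes B (A i.+1)^T j.
Proof.
move=> ext.
have [|D [q [qs qk]]] := @quotient_module_exists R 'rV[R]_(r i.+2)
    (fun u => exists v, u = v *m (A i.+1)^T).
  split; first by exists 0; rewrite mul0mx.
    by move=> _ _ [v ->] [w ->]; exists (v + w); rewrite mulmxDl.
  by move=> c _ [v ->]; exists (c *: v); rewrite scalemxAl.
have D_fg : fin_generated D.
  apply/fin_generatedP; exists (r i.+2), (fun p => q (delta_mx 0 p)) => z.
  by have [u <-] := qs z; exists u; rewrite linear_rV_lincomb.
suff tor1 j : Tor_vanishes j.+1 N D by move=> j; apply/(Tor_vanishes_mx resB qs qk).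
elim: j => [|j IHj]; last exact: N_rigid.
apply/(Tor_vanishes_mx resB qs qk) => Y X YX.
have [exB _ _] := resB.
have VB : A i.+1 *m X^T = Y^T *m B 0%N.
  by rewrite -[A _]trmxK -trmx_mul -YX trmx_mul trmxK.
have [W [V' XE]] := Ext_vanishes_mx resA resB ext VB.
have [exA _ _] := resA.
have [|V VE] := (exB 0%N isT).2 _ (Y^T - A i.+1 *m V').
  rewrite mulmxBl -VB XE mulmxDr mulmxA (exA i isT).1 mul0mx add0r mulmxA.
  by rewrite subrr.
exists V^T, V'^T; rewrite -!trmx_mul -linearD /= -VE.
by rewrite subrK trmxK.
Qed.

(** Balancing of Tor by a diagonal chase: passing from [U] to [V] moves from [(i.+1, l)] to
    [(i, l.+1)], until at [i = 0] the transposed equation falls under the hypothesis. On the way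
    back exactness of [C] recovers [U]. *)
Lemma mx_tor_vanishes_tor_from t (C : forall i, 'M[R]_(t i.+1, t i)) :
  exact_from 0 C -> (forall j, mx_tor_vanishes B (C 0%N) j) -> tor_from 0 C B.
Proof.
move=> exC tor i l _ _; have [exB _ _] := resB.
elim: i l => [|i IHi] l U V UV.
  have [|Y [X VE]] := tor l V^T U^T; first by rewrite -trmx_mul -UV trmx_mul trmxK.
  have {}VE : V = Y^T *m B l.+1 + (C 0%N)^T *m X^T.
    by rewrite -[V]trmxK VE linearD /= !trmx_mul trmxK.
  have [|W WE] := exm_tr (exC 0%N isT) (U := U - X^T *m B l).
    rewrite mulmxBr UV VE mulmxDl -mulmxA (exB l isT).1 mulmx0 add0r mulmxA.
    by rewrite subrr.
  by exists W, X^T; rewrite -WE subrK.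
have [|V1 VE] := (exB l isT).2 _ ((C i)^T *m V).
  by rewrite -mulmxA -UV mulmxA -trmx_mul (exC i isT).1 trmx0 mul0mx.
have [W [V' {}VE]] := IHi l.+1 V V1 VE.
have [|W' WE] := exm_tr (exC i.+1 isT) (U := U - W *m B l).
  rewrite mulmxBr UV VE mulmxDl -[V' *m _ *m _]mulmxA (exB l isT).1 mulmx0 addr0.
  by rewrite mulmxA subrr.
by exists W', W; rewrite -WE subrK.
Qed.

(* [Tor_2(D, N) -> Ext^(i+1)(M, R) (x) N -> Ext^(i+1)(M, N)] is exact and its
   ends vanish, so [Ext^(i+1)(M, R) = 0] by Nakayama. *)
Lemma ext_vanishes_dual_exact i : Ext_vanishes i.+1 M N -> exm (A i)^T (A i.+1)^T.
Proof.
move=> ext; have [exA _ _] := resA; have [exB _ sB] := resB.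
have [t [C1 [C [C1P exC1 exC C0]]]] := resolution_exists fg (mulmxr_lin (A i.+1)^T).
have exC1A : exm C1 (A i.+1)^T by apply: exm_row.
have tor : tor_from 0 (cons_mx (A i.+1)^T (cons_mx C1 C)) B.
  apply: mx_tor_vanishes_tor_from; last exact: ext_vanishes_tor.
  by apply: exact_from_cons => //; apply: exact_from_cons.
have zA : (A i)^T *m (A i.+1)^T = 0 by rewrite -trmx_mul (exA i isT).1 trmx0.
have [H HE] := exC1A.2 _ _ zA.
have AE : A i = C1^T *m H^T by rewrite -trmx_mul -HE trmxK.
have zC1 : A i.+1 *m C1^T = 0 by rewrite -[A _]trmxK -trmx_mul exC1A.1 trmx0.
have [q _] : exists q : 'I_(s 0%N), True.
  have [w w0] := N_nz; have [u wE] := sB w; case: (s 0%N) b u wE => [|m] b' u wE.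
    by rewrite wE /lincomb big_ord0 eqxx in w0.
  by exists ord0.
(* The [p]-th column of [C1^T] times the [q]-th generator of [N] is a cocycle with values in [N],
   hence a coboundary, given by [W]. The vanishing of Tor puts the error [delta_mx p q - H^T *m W]
   into the span of [(C 0)^T] and [B 0], so its entries are nonunits. *)
have /choice[W WP] : forall p, exists W, mx_nonunit (delta_mx p q - H^T *m W).
  move=> p; have [|W [V VE]] :=
      Ext_vanishes_mx resA resB ext (U := C1^T *m delta_mx p q) (V := 0).
    by rewrite mulmxA zC1 !mul0mx.
  exists W; have [//|//||W' [V' ->]] := tor 1%N 0%N _ _ (delta_mx p q - H^T *m W) V.
    by rewrite /= mulmxBr mulmxA -AE VE addrC addKr.
  apply: (mx_nonunitD loc); last by apply: mx_nonunitMl => //; exact: B0.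
  by apply: mx_nonunitMr => //; apply: mx_nonunit_tr; apply: (C0 0%N).
(* The [q]-th columns for all [p] together show that [H^T *m W0] is the identity modulo nonunits,
   hence invertible; so [C1^T] factors through [A i]. *)
pose W0 := \matrix_(k, p) W p k q.
have [|G GE] := one_plus_nonunit_inv loc (Y := H^T *m W0).
  move=> k p; have /nonunitN := WP p k q; congr nonunit.
  rewrite !mxE opprB eqxx andbT; congr (_ - _).
  by apply: eq_bigr => l _; rewrite !mxE.
have C1E : C1 = (W0 *m G)^T *m (A i)^T.
  by rewrite -trmx_mul AE -mulmxA [H^T *m _]mulmxA GE mulmx1 trmxK.
split=> // k U UA; have [V ->] := exC1A.2 _ _ UA.
by exists (V *m (W0 *m G)^T); rewrite -mulmxA -C1E.
Qed.

(** Induction on [k], prefixing one dual matrix at a time. In degree [k.+1] generating syzygies of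
    [(A i.+1)^T] stand in for [(A i)^T]; each factors through the other, which gives nonunit entries
    and lets vanishing under [pi] pass to [A i]. *)
Lemma dual_complex i k :
  (forall j, (j <= k)%N -> exm (A (j + i))^T (A (j + i).+1)^T) ->
  exists t (C0 : 'M[R]_(t 0%N, r (k + i).+1)) (C : forall j, 'M[R]_(t j.+1, t j)),
  let F := cons_mx (A (k + i).+1)^T (cons_mx C0 C) in
  [/\ exact_from 0 F, forall j, mx_nonunit (F j) &
      forall (R' : comNzRingType) (pi : {rmorphism R -> R'}),
        map_mx pi (F k.+1) = 0 -> map_mx pi (A i) = 0].
Proof.
elim: k => [|k IHk] exAt.
  have [t [C0 [C [C0P exC0 exC minC]]]] :=
    resolution_exists fg (mulmxr_lin (A i.+1)^T).
  have exC0A : exm C0 (A i.+1)^T by apply: exm_row.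
  have [z ex] := exAt 0%N isT.
  have [V VE] := ex _ _ exC0A.1; have [H HE] := exC0A.2 _ _ z.
  exists t, C0, C => F; split.
  - by apply: exact_from_cons => //; apply: exact_from_cons.
  - case=> [|[|j]] /=; [exact: mx_nonunit_tr| |exact: minC].
    by rewrite VE; apply: mx_nonunitMl => //; apply: mx_nonunit_tr.
  - move=> R' pi /= C00; rewrite -[A i]trmxK -map_trmx HE map_mxM C00 mulmx0.
    by rewrite trmx0.
have [|t [C0 [C [exF minF zF]]]] := IHk.
  by move=> j jk; apply: exAt; apply: leqW.
exists (cons_rank (r (k + i).+1) t), (A (k + i).+1)^T, (cons_mx C0 C) => F; split.
- apply: exact_from_cons => //; exact: (exAt k.+1).
- by case=> [|j] /=; [exact: mx_nonunit_tr|exact: minF].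
- exact: zF.
Qed.

End RigidTor.

(** * Conclusion in the quotient by the regular sequence *)

Theorem corollary3p22 (R : comNzRingType) (d n : nat) (x : n.-tuple R)
    (M N : lmodType R)
    (hR : gorenstein R) (hd : krull_dimension R d)
    (hx : quasi_fiber_product_ring x)
    (M_fg : fin_generated M) (M_nz : nonzero_module M)
    (N_fg : fin_generated N) (N_nz : nonzero_module N)
    (N_rigid : Tor_rigid N)
    (hExt : exists t : nat, (n < t)%N /\
       forall i : nat, (t <= i <= t + n)%N -> Ext_vanishes i M N) :
  finite_proj_dim M \/ finite_proj_dim N.
Proof.
case: hR => noethR localR [E [l El]].
have fg := noetherian_ideals_fg noethR.
have loc := local_nonunits_closed noethR localR.
have [R' [pi [a [b [[loc' fg'] ab piN exP torP]]]]] :=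
  quasi_fiber_product_quotient noethR localR (inj_resolution_dual_exact El) hx.
rewrite size_tuple in exP torP.
have [r [A [u [resA A0]]]] := minimal_resolution_exists fg M_fg.
have [s [B [v [resB B0]]]] := minimal_resolution_exists fg N_fg.
(* Here [t = i.+1], so that [n < t] becomes [n <= i]. *)
case: hExt => -[|i] [ni ext] //.
have {}ext k : (k <= n)%N -> Ext_vanishes (k + i).+1 M N.
  by move=> kn; apply: ext; rewrite ltnS leq_addl addSn ltnS addnC leq_add2l.
have [|t [C0 [C [exF F0 piF]]]] := dual_complex loc fg A0 (i := i) (k := n).
  move=> k kn.
  exact: (ext_vanishes_dual_exact loc fg resA resB B0 N_nz N_rigid (ext k kn)).
have piN' p q (D : 'M[R]_(p, q)) : mx_nonunit D -> mx_nonunit (map_mx pi D).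
  by move=> D0 j k; rewrite mxE; apply: piN.
have [exA _ _] := resA; have [exB _ _] := resB.
have torFB := mx_tor_vanishes_tor_from resB exF
  (ext_vanishes_tor resA resB N_rigid (ext n (leqnn n))).
have [piF0|piB0] := two_lines_tor loc' fg' ab
    (exP _ _ exF) (fun j => piN' _ _ _ (F0 j))
    (exP _ _ exB) (fun j => piN' _ _ _ (B0 j)) (torP _ _ _ _ exF exB torFB).
  (* Since [n <= i], the complex [A] is still exact at [A i] modulo [(x)]; as [A i] vanishes there,
     [r i.+1 = 0], and ranks are the same over [R]. *)
  left; apply: (minimal_resolution_finite loc resA A0 (l := i)).
  exact: (exm_zero_rank loc' (exP _ _ exA i ni) (piN' _ _ _ (A0 _)) (piF _ _ piF0)).
right; apply: (minimal_resolution_finite loc resB B0 (l := n.+1)).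
exact: (exm_zero_rank loc' (exP _ _ exB n.+1 (leqnSn n)) (piN' _ _ _ (B0 _)) piB0).
Qed.
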